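(* Every topological group $G$ is isomorphic, as a topological group, to a subgroup of a complete minimal group which is Roelcke-precompact, topologically simple and has the same weight as $G$.
   Context: All topological groups are assumed to be Hausdorff; subgroups carry the subspace topology. For a topological group $H$, let $\mathcal N(H)$ be the filter of neighbourhoods of the neutral element. $H$ is complete if it is complete with respect to the upper uniformity $\mathcal L\vee\mathcal R$, the least upper bound of the left uniformity $\mathcal L$ (basic entourages $\{(x,y):x^{-1}y\in U\}$, $U\in\mathcal N(H)$) and the right uniformity $\mathcal R$ (basic entourages $\{(x,y):yx^{-1}\in U\}$, $U\in\mathcal N(H)$). $H$ is minimal if it does not admit a strictly coarser Hausdorff group topology. $H$ is Roelcke-precompact if it is precompact with respect to the greatest lower bound $\mathcal L\wedge\mathcal R$ of $\mathcal L$ and $\mathcal R$; equivalently, for every $U\in\mathcal N(H)$ there exists a finite set $F\subset H$ such that $UFU=H$. $H$ is topologically simple if it has no closed normal subgroups besides $H$ and $\{1\}$. The weight of a topological space $X$ is the cardinal $w(X)=\min\{|\mathcal B|:\mathcal B\text{ is a base for }X\}$.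
   Formalization: For finite G, ''has the same weight as G'' is replaced by ''has a countable base'' (weights read as infinite cardinals), since literal equality would force the overgroup to equal G and fails e.g. for Z/4; for infinite G the weights are literally equal. *)

(* Defs.v *)
From HB Require Import structures.
From mathcomp Require Import all_boot all_classical topology.
Set Implicit Arguments.
Unset Strict Implicit.
Unset Printing Implicit Defensive.

Local Open Scope classical_set_scope.
Local Open Scope group_scope.

(* The topology is a separate argument, rather than the one of a canonical
   structure, so that one can quantify over the topologies of a fixed group. *)
Definition group_topology (T : groupType) (t : Topological T) : Prop :=
  let X : topologicalType := Topological.Pack t in
  continuous (fun x : X * X => (x.1 : T) * (x.2 : T) : X) /\
  continuous (fun x : X => (x : T)^-1 : X).

#[short(type="groupTopologicalType")]
HB.structure Definition GroupTopological := {G of Topological G & Group G}.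

HB.mixin Record GroupTopological_isTopologicalGroup G of GroupTopological G := {
  group_topology_subproof : @group_topology G (Topological.class G)
}.

(* Not assumed to be Hausdorff. *)
#[short(type="topologicalGroupType")]
HB.structure Definition TopologicalGroup :=
  {G of GroupTopological G & GroupTopological_isTopologicalGroup G}.

Section TopologicalGroupTheory.
Variable G : topologicalGroupType.

Lemma mulg_continuous : continuous (fun x : G * G => x.1 * x.2).
Proof. exact: (@group_topology_subproof G).1. Qed.

Lemma invg_continuous : continuous (fun x : G => x^-1).
Proof. exact: (@group_topology_subproof G).2. Qed.

Lemma nbhs1_inv (U : set G) : nbhs 1 U -> nbhs 1 [set x : G | U x^-1].
Proof. by move=> U1; apply: invg_continuous; rewrite invg1. Qed.

Lemma nbhs1_split (U : set G) : nbhs 1 U ->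
  exists2 V : set G, nbhs 1 V & forall x y, V x -> V y -> U (x * y).
Proof.
move=> U1; have /= := @mulg_continuous (1, 1) U.
rewrite mulg1 => /(_ U1)[[A B] /= [A1 B1] AB].
by exists (A `&` B) => [|x y [Ax _] [_ By]]; [exact: filterI|exact: (AB (x, y))].
Qed.

End TopologicalGroupTheory.

Definition left_uniform (G : Type) : Type := G.
Definition right_uniform (G : Type) : Type := G.

Section LeftRight.
Local Open Scope relation_scope.
Variable G : topologicalGroupType.

Definition left_entourage : set_system (G * G) :=
  filter_from (nbhs (1 : G)) (fun U => [set xy | U (xy.1^-1 * xy.2)%g]).

Definition right_entourage : set_system (G * G) :=
  filter_from (nbhs (1 : G)) (fun U => [set xy | U (xy.2 * xy.1^-1)%g]).

Let left_filter : Filter left_entourage.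
Proof.
apply: filter_from_filter; first by exists setT; exact: filterT.
by move=> U V U1 V1; exists (U `&` V) => //; exact: filterI.
Qed.

Let left_diagonal A : left_entourage A -> diagonal `<=` A.
Proof.
move=> [U U1 UA] [x y] /= /diagonalP ->; apply: UA => /=.
by rewrite mulVg; exact: nbhs_singleton.
Qed.

Let left_inv A : left_entourage A -> left_entourage A^-1.
Proof.
move=> [U /nbhs1_inv U1 UA]; exists [set x : G | U x^-1%g] => // -[x y] /=.
by rewrite invgM invgK => Uxy; apply: UA.
Qed.

Let left_split A : left_entourage A ->
  exists2 B, left_entourage B & B \; B `<=` A.
Proof.
move=> [U /nbhs1_split[V V1 VU] UA].
exists [set xy | V (xy.1^-1 * xy.2)%g]; first by exists V.
move=> [x y] [z /= Vxz Vzy]; apply: UA => /=.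
by have := VU _ _ Vxz Vzy; rewrite -mulgA mulVKg.
Qed.

Let right_filter : Filter right_entourage.
Proof.
apply: filter_from_filter; first by exists setT; exact: filterT.
by move=> U V U1 V1; exists (U `&` V) => //; exact: filterI.
Qed.

Let right_diagonal A : right_entourage A -> diagonal `<=` A.
Proof.
move=> [U U1 UA] [x y] /= /diagonalP ->; apply: UA => /=.
by rewrite mulgV; exact: nbhs_singleton.
Qed.

Let right_inv A : right_entourage A -> right_entourage A^-1.
Proof.
move=> [U /nbhs1_inv U1 UA]; exists [set x : G | U x^-1%g] => // -[x y] /=.
by rewrite invgM invgK => Uxy; apply: UA.
Qed.

Let right_split A : right_entourage A ->
  exists2 B, right_entourage B & B \; B `<=` A.
Proof.
move=> [U /nbhs1_split[V V1 VU] UA].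
exists [set xy | V (xy.2 * xy.1^-1)%g]; first by exists V.
move=> [x y] [z /= Vxz Vzy]; apply: UA => /=.
by have := VU _ _ Vzy Vxz; rewrite mulgA mulgVK.
Qed.

HB.instance Definition _ := Choice.on (left_uniform G).
HB.instance Definition _ := @isUniform.Build (left_uniform G) left_entourage
  left_filter left_diagonal left_inv left_split.

HB.instance Definition _ := Choice.on (right_uniform G).
HB.instance Definition _ := @isUniform.Build (right_uniform G) right_entourage
  right_filter right_diagonal right_inv right_split.

End LeftRight.

Section UpperLower.
Variable G : topologicalGroupType.

Definition left_uniformity : Uniform G := Uniform.class (left_uniform G).
Definition right_uniformity : Uniform G := Uniform.class (right_uniform G).

Definition coarser_uniformity (u v : Uniform G) : Prop :=
  @entourage (Uniform.Pack u) `<=` @entourage (Uniform.Pack v).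

Definition upper_uniform : uniformType :=
  sup_topology (fun b : bool => if b then left_uniformity else right_uniformity).

(* In the lattice of uniformities, a greatest lower bound is the supremum of
   all lower bounds. *)
Definition roelcke_uniform : uniformType :=
  sup_topology (fun u : {u : Uniform G | coarser_uniformity u left_uniformity /\
                                         coarser_uniformity u right_uniformity}
                => sval u).

End UpperLower.

Definition complete_uniform (T : uniformType) : Prop :=
  forall F : set_system T, ProperFilter F -> cauchy F -> exists x : T, F --> x.

Definition precompact_uniform (T : uniformType) : Prop :=
  forall E : set (T * T), entourage E ->
    exists2 F : set T, finite_set F & \bigcup_(x in F) xsection E x = setT.

Definition complete_group (G : topologicalGroupType) : Prop :=
  complete_uniform (upper_uniform G).

Definition roelcke_precompact (G : topologicalGroupType) : Prop :=
  precompact_uniform (roelcke_uniform G).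

Definition minimal_group (G : topologicalGroupType) : Prop :=
  forall t : Topological G,
    group_topology t -> hausdorff_space (Topological.Pack t) ->
    @open (Topological.Pack t) `<=` @open G ->
    @open (Topological.Pack t) = @open G.

Definition normal_subgroup (G : groupType) (N : set G) : Prop :=
  group_closed (mem N) /\ forall x y : G, N x -> N (x ^ y).

Definition topologically_simple (G : topologicalGroupType) : Prop :=
  forall N : set G, closed N -> normal_subgroup N -> N = setT \/ N = [set 1].

(* f is an isomorphism of topological groups onto the subgroup range f, whose
   open sets are the traces on range f of the open sets of H. *)
Definition topological_group_embedding (G H : topologicalGroupType)
    (f : G -> H) : Prop :=
  [/\ {morph f : x y / x * y}, injective f &
      forall A : set G, open A <->
        exists2 B : set H, open B & f @` A = range f `&` B].

Local Open Scope card_scope.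

Definition minimum_basis (T : topologicalType) (B : set_system T) : Prop :=
  basis B /\ forall C : set_system T, basis C -> B #<= C.

(* Finite values are possible: a finite Hausdorff group is discrete and its weight
   is its order, so no proper overgroup has the same weight. Under the
   convention that weights are infinite cardinals, having the same weight as a
   finite group means being second countable. *)
Definition same_weight (X Y : topologicalType) : Prop :=
  exists (B : set_system X) (C : set_system Y),
    [/\ minimum_basis B, minimum_basis C & B #= C].

(* Main.v *)
Require Import Defs.
From HB Require Import structures.
From mathcomp Require Import all_boot all_order all_algebra all_classical.
From mathcomp Require Import all_reals topology lra finmap Rstruct.
From Stdlib Require List.
Set Implicit Arguments.
Unset Strict Implicit.
Unset Printing Implicit Defensive.
Import Order.TTheory GRing.Theory Num.Theory.
Local Open Scope classical_set_scope.
Local Open Scope ring_scope.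


(** Let [G] act continuously by isometries on a bounded metric space [X].
    Prescribing the distances [c x y] from an image of [x] under an unknown
    isometry to [y], for a bi-Katetov function [c] on [X], one can adjoin to [X]
    generic copies [(c, x)] of its points, for all [c] whose [G]-orbit is
    norm-continuous at once; the isometric embedding [x |-> (c, x)] is again
    described by a bi-Katetov function on the larger space.  Iterating, the
    union carries for each [c] an isometry with the prescribed distances, and
    [G] still acts continuously.  Starting from the right uniformly continuous
    functions on [G], a Loewenheim-Skolem argument and a completion yield a
    complete space [M] of density at most the weight of [G], on which [G] acts
    faithfully and topologically, such that every finitely supported bi-Katetov
    function is approximately realized by an isometry.  The overgroup is the
    group [H] of isometries of [M] with pointwise convergence.

    In [H], almost isometric tuples are almost conjugate, hence Roelcke
    precompactness.  For simplicity and minimality, let [V] be a closed normal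
    subgroup, or a small neighbourhood of [1] in a coarser Hausdorff group
    topology.  If elements of [V] move some point uniformly far from any finite
    set (otherwise an ultrafilter of small elements converges to [1] in [H]),
    products of generic conjugates move all points of a given finite set as far
    as possible from that set, and then [V * U * V^-1 = H] for all
    neighbourhoods [U] of [1]. *)

(** * Capped infima and sup distances *)

Section CappedInfimum.
Variable R : realType.

(** Adding 1 and dropping negative elements keeps the set nonempty and bounded below, so the infimum
    always exists and lies in the unit interval. *)
Definition cinf (A : set R) : R := inf [set r | r = 1 \/ (A r /\ 0 <= r)].

Lemma cinf_lbound (A : set R) : lbound [set r : R | r = 1 \/ (A r /\ 0 <= r)] 0.
Proof. by move=> r [->|[]]. Qed.

Lemma cinf_le1 A : cinf A <= 1.
Proof. by apply: ge_inf; [exists 0; exact: cinf_lbound|left]. Qed.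

Lemma cinf_le A a : A a -> 0 <= a -> cinf A <= a.
Proof. by move=> Aa a0; apply: ge_inf; [exists 0; exact: cinf_lbound|right]. Qed.

Lemma le_cinf A t : t <= 1 -> (forall a, A a -> 0 <= a -> t <= a) -> t <= cinf A.
Proof.
move=> t1 tA; apply: lb_le_inf; first by exists 1; left.
by move=> r [->//|[Ar r0]]; exact: tA.
Qed.

Lemma cinf_ge0 A : 0 <= cinf A.
Proof. exact: le_cinf. Qed.

Lemma le_cinfB A s t : t <= 1 + s ->
  (forall a, A a -> 0 <= a -> t <= a + s) -> t <= cinf A + s.
Proof.
move=> t1 tA; rewrite -lerBlDr; apply: le_cinf; first by lra.
by move=> a Aa a0; have := tA a Aa a0; lra.
Qed.

(** The uniform distance of unit-valued functions, taken as an infimum of upper bounds so that an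
    empty [T] gives 0. *)
Definition supdist T (f g : T -> R) : R := cinf [set e | forall t, `|f t - g t| <= e].

Lemma supdist_le T (f g : T -> R) e : 0 <= e -> (forall t, `|f t - g t| <= e) ->
  supdist f g <= e.
Proof. by move=> e0 fge; exact: cinf_le. Qed.

Lemma le_supdist T (f g : T -> R) t : `|f t - g t| <= 1 -> `|f t - g t| <= supdist f g.
Proof. by move=> fg1; apply: le_cinf => // a + _; exact. Qed.

Lemma supdist_ge0 T (f g : T -> R) : 0 <= supdist f g.
Proof. exact: cinf_ge0. Qed.

Lemma supdist_le1 T (f g : T -> R) : supdist f g <= 1.
Proof. exact: cinf_le1. Qed.

Lemma supdistxx T (f : T -> R) : supdist f f = 0.
Proof.
apply/eqP; rewrite eq_le supdist_ge0 andbT; apply: supdist_le => // t.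
by rewrite subrr normr0.
Qed.

Lemma supdistC T (f g : T -> R) : supdist f g = supdist g f.
Proof. by congr cinf; apply/seteqP; split=> e /= fg t; rewrite distrC. Qed.

Definition unit_valued T (f : T -> R) := forall t, 0 <= f t <= 1.

Lemma unit_valued_dist T (f g : T -> R) t :
  unit_valued f -> unit_valued g -> `|f t - g t| <= 1.
Proof. by move=> /(_ t)/andP[? ?] /(_ t)/andP[? ?]; rewrite ler_norml; lra. Qed.

Lemma supdist_triangle T (f g h : T -> R) :
  unit_valued f -> unit_valued g -> unit_valued h ->
  supdist f h <= supdist f g + supdist g h.
Proof.
move=> f1 g1 h1; apply: supdist_le; first by rewrite addr_ge0 ?supdist_ge0.
move=> t; have := le_supdist (unit_valued_dist t f1 g1).
have := le_supdist (unit_valued_dist t g1 h1).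
by rewrite !ler_norml; lra.
Qed.

Lemma supdist_eq0 T (f g : T -> R) : unit_valued f -> unit_valued g ->
  supdist f g <= 0 -> f = g.
Proof.
move=> f1 g1 fg0; apply/funext => t; apply/eqP; rewrite -subr_eq0 -normr_le0.
exact: le_trans (le_supdist (unit_valued_dist t f1 g1)) fg0.
Qed.

End CappedInfimum.

(** * Translates and conjugates of neighbourhoods *)

Section GroupNeighbourhoods.
Local Open Scope group_scope.
Variable G : topologicalGroupType.

Lemma nbhs1_mulgl (g : G) (U : set G) : nbhs g U -> nbhs 1 [set u : G | U (u * g)].
Proof.
move=> gU; have /= := @mulg_continuous G (1, g) U.
rewrite /= mul1g => /(_ gU)[[A B] /= [A1 B1] AB].
apply: filterS A1 => x Ax; apply: (AB (x, g)); split=> //=.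
exact: nbhs_singleton.
Qed.

Lemma nbhs_mulgl (g : G) (U : set G) : nbhs 1 U -> nbhs g [set x : G | U (x * g^-1)].
Proof.
move=> gU; have /= := @mulg_continuous G (g, g^-1) U.
rewrite /= mulgV => /(_ gU)[[A B] /= [A1 B1] AB].
apply: filterS A1 => x Ax; apply: (AB (x, g^-1)); split=> //=.
exact: nbhs_singleton.
Qed.

Lemma nbhs1_conjg (g : G) (U : set G) : nbhs 1 U -> nbhs 1 [set u : G | U (g^-1 * u * g)].
Proof.
move=> U1; have : nbhs g [set u : G | U (g^-1 * u)].
  have /= := @mulg_continuous G (g^-1, g) U.
  rewrite /= mulVg => /(_ U1)[[A B] /= [A1 B1] AB].
  apply: filterS B1 => x Bx; apply: (AB (g^-1, x)); split=> //=.
  exact: nbhs_singleton.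
by move=> /nbhs1_mulgl; apply: filterS => x /=; rewrite mulgA.
Qed.

End GroupNeighbourhoods.

(** * Adjoining generic isometries *)

Section GSpaces.
Variables (R : realType) (G : topologicalGroupType).

(** Only a pseudometric: points at distance zero are not identified before the completion. As the
    action is isometric, continuity of the orbit maps at 1 gives continuity of the action. *)
Record gspace := GSpace {
  point :> Type;
  dist : point -> point -> R;
  gact : G -> point -> point;
  dist_ge0 : forall x y, 0 <= dist x y;
  dist_le1 : forall x y, dist x y <= 1;
  distxx : forall x, dist x x = 0;
  distC : forall x y, dist x y = dist y x;
  dist_triangle : forall y x z, dist x z <= dist x y + dist y z;
  dist_gact : forall g x y, dist (gact g x) (gact g y) = dist x y;
  gact1 : forall x, gact 1%g x = x;
  gactM : forall g h x, gact (g * h)%g x = gact g (gact h x);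
  gact_near1 : forall x e, 0 < e -> nbhs (1%g : G) [set g | dist (gact g x) x <= e]
}.

Lemma gactK (X : gspace) g : cancel (@gact X g) (gact g^-1%g).
Proof. by move=> x; rewrite -gactM mulVg gact1. Qed.

Lemma gactKV (X : gspace) g : cancel (@gact X g^-1%g) (gact g).
Proof. by move=> x; rewrite -gactM mulgV gact1. Qed.

(* [c x y] is the distance from the image of [x] under a generic partial
   isometry to [y]. *)
Record biKatetov (X : gspace) := BiKatetov {
  cost :> X -> X -> R;
  cost_ge0 : forall x y, 0 <= cost x y;
  cost_le1 : forall x y, cost x y <= 1;
  cost_lipl : forall x x' y, cost x y <= dist x x' + cost x' y;
  cost_lipr : forall x y y', cost x y <= cost x y' + dist y' y;
  cost_katl : forall x x' y, dist x x' <= cost x y + cost x' y;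
  cost_katr : forall x y y', dist y y' <= cost x y + cost x y';
  cost_near1 : forall e, 0 < e -> nbhs (1%g : G)
    [set g | forall x y, `|cost (gact g x) (gact g y) - cost x y| <= e]
}.

Lemma biKatetov_ext (X : gspace) (c c' : biKatetov X) : cost c = cost c' -> c = c'.
Proof.
case: c c' => [c p1 p2 p3 p4 p5 p6 p7] [c' q1 q2 q3 q4 q5 q6 q7] /= cc'.
by subst c'; congr BiKatetov; exact: Prop_irrelevance.
Qed.

(** If [c] describes an isometry, this describes its inverse. *)
Program Definition bikatT (X : gspace) (c : biKatetov X) : biKatetov X :=
  @BiKatetov X (fun x y => c y x) _ _ _ _ _ _ _.
Next Obligation. move=> X c x y /=. exact: cost_ge0. Qed.
Next Obligation. move=> X c x y /=. exact: cost_le1. Qed.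
Next Obligation. move=> X c x x' y /=. by rewrite addrC distC; exact: cost_lipr. Qed.
Next Obligation. move=> X c x y y' /=. by rewrite addrC distC; exact: cost_lipl. Qed.
Next Obligation. move=> X c x x' y /=. exact: cost_katr. Qed.
Next Obligation. move=> X c x y y' /=. exact: cost_katl. Qed.
Next Obligation. move=> X c e H /=.
by apply: filterS (cost_near1 c H) => g cg x y; exact: cg.
Qed.

(** All images are as far as possible from all points; used as a default value. *)
Program Definition bikat1 (X : gspace) : biKatetov X :=
  @BiKatetov X (fun _ _ => 1) _ _ _ _ _ _ _.
Next Obligation. by []. Qed.
Next Obligation. by []. Qed.
Next Obligation. by move=> X x x' y /=; have := dist_ge0 x x'; lra. Qed.
Next Obligation. by move=> X x y y' /=; have := dist_ge0 y' y; lra. Qed.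
Next Obligation. by move=> X x x' y /=; have := dist_le1 x x'; lra. Qed.
Next Obligation. by move=> X x y y' /=; have := dist_le1 y y'; lra. Qed.
Next Obligation.
move=> X e H /=; by apply: nearW => g x y; rewrite subrr normr0 ltW.
Qed.

(** The cost function of the conjugate by [g] of the isometry described by [c]. *)
Program Definition bikat_act (X : gspace) (g : G) (c : biKatetov X) : biKatetov X :=
  @BiKatetov X (fun x y => c (gact g^-1%g x) (gact g^-1%g y)) _ _ _ _ _ _ _.
Next Obligation. move=> X g c x y /=.  exact: cost_ge0. Qed.
Next Obligation. move=> X g c x y /=.  exact: cost_le1. Qed.
Next Obligation. move=> X g c x x' y /=. by rewrite -(dist_gact g^-1%g x); exact: cost_lipl. Qed.
Next Obligation. move=> X g c x y y' /=. by rewrite -(dist_gact g^-1%g y'); exact: cost_lipr. Qed.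
Next Obligation. move=> X g c x x' y /=. by rewrite -(dist_gact g^-1%g x); exact: cost_katl. Qed.
Next Obligation. move=> X g c x y y' /=. by rewrite -(dist_gact g^-1%g y); exact: cost_katr. Qed.
Next Obligation. move=> X g c e H /=. apply: filterS (nbhs1_conjg g (cost_near1 c H)) => h /= ch x y.
by have := ch (gact g^-1%g x) (gact g^-1%g y); rewrite -!gactM mulgK.
Qed.

Lemma bikat_act_near1 (X : gspace) (c : biKatetov X) e : 0 < e ->
  nbhs (1%g : G) [set g | forall x y, `|bikat_act g c x y - c x y| <= e].
Proof.
by move=> e0; apply: filterS (nbhs1_inv (cost_near1 c e0)) => g /=.
Qed.

(** * One step: a copy of the space for every bi-Katetov function *)

Section Step.
Variable X : gspace.

Definition steppt : Type := (X + biKatetov X * X)%type.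

(* Upper bounds on the distance between two new points: move the point and
   change the isometry, or pass through an old point [y]. *)
Definition newset (p q : biKatetov X * X) : set R := [set r |
  (exists2 e, forall u v, `|p.1 u v - q.1 u v| <= e & r = dist p.2 q.2 + e) \/
  (exists y, r = p.1 p.2 y + q.1 q.2 y)].

Definition stepdist (p q : steppt) : R :=
  match p, q with
  | inl x, inl y => dist x y
  | inr cx, inl y => cx.1 cx.2 y
  | inl y, inr cx => cx.1 cx.2 y
  | inr cx, inr cy => cinf (newset cx cy)
  end.

Definition stepact (g : G) (p : steppt) : steppt :=
  match p with
  | inl x => inl (gact g x)
  | inr cx => inr (bikat_act g cx.1, gact g cx.2)
  end.

Lemma newset_sym p q : newset p q `<=` newset q p.
Proof.
move=> r [[e pq ->]|[y ->]]; [left|by right; exists y; rewrite addrC].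
by exists e => [u v|]; rewrite ?(distC q.2)// distrC.
Qed.

Lemma stepdistC p q : stepdist p q = stepdist q p.
Proof.
case: p q => [x|p] [y|q] //=; first exact: distC.
by congr cinf; apply/seteqP; split; exact: newset_sym.
Qed.

Lemma newdist_le c c' x x' e : (forall u v, `|cost c u v - cost c' u v| <= e) ->
  stepdist (inr (c, x)) (inr (c', x')) <= dist x x' + e.
Proof.
move=> cc'; apply: cinf_le; first by left; exists e.
by rewrite addr_ge0 ?dist_ge0//; exact: le_trans (cc' x x).
Qed.

(** A detour through an old point is no shortcut, by [cost_katl]. Hence sending [x] to [(c, x)] is
    an isometric embedding. *)
Lemma stepdist_same c x x' : stepdist (inr (c, x)) (inr (c, x')) = dist x x'.
Proof.
apply/eqP; rewrite eq_le; apply/andP; split.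
  rewrite -[leRHS]addr0; apply: newdist_le => u v.
  by rewrite subrr normr0.
apply: le_cinf => [|r [[e /= ce ->]|[y ->]] _ /=]; first exact: dist_le1.
  by have := le_trans (normr_ge0 _) (ce x x); lra.
exact: cost_katl.
Qed.

Lemma stepdist_ge0 p q : 0 <= stepdist p q.
Proof.
by case: p q => [x|p] [y|q] /=; [exact: dist_ge0|exact: cost_ge0|exact: cost_ge0|exact: cinf_ge0].
Qed.

Lemma stepdist_le1 p q : stepdist p q <= 1.
Proof.
by case: p q => [x|p] [y|q] /=; [exact: dist_le1|exact: cost_le1|exact: cost_le1|exact: cinf_le1].
Qed.

Lemma stepdistxx p : stepdist p p = 0.
Proof. by case: p => [x|[c x]]; rewrite ?stepdist_same; exact: distxx. Qed.

Let norm_le (a b e : R) : `|a - b| <= e -> a <= b + e /\ b <= a + e.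
Proof. by rewrite ler_norml; lra. Qed.

(** The letters [l] and [r] in the names of the triangle inequalities tell which of the three points
    are old and which are new; the remaining cases follow by symmetry or directly from the
    definitions. *)
Let tri_llr x y c z :
  stepdist (inl x) (inr (c, z)) <= stepdist (inl x) (inl y) + stepdist (inl y) (inr (c, z)).
Proof. by rewrite /= addrC (distC x); exact: cost_lipr. Qed.

Let tri_lrr x c y c' z :
  stepdist (inl x) (inr (c', z)) <=
  stepdist (inl x) (inr (c, y)) + stepdist (inr (c, y)) (inr (c', z)).
Proof.
rewrite /= addrC; apply: le_cinfB.
  by have := cost_le1 c' z x; have := cost_ge0 c y x; lra.
move=> r [[e /= cc' ->]|[u -> /=]] _.
  have [_ ?] := norm_le (cc' z x).
  have := cost_lipl c z y x; rewrite (distC z).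
  by have := cc' z x; lra.
have := cost_katr c y u x; have := cost_lipr c' z x u.
by lra.
Qed.

Let tri_rrr p q r : stepdist (inr p) (inr r) <= stepdist (inr p) (inr q) + stepdist (inr q) (inr r).
Proof.
case: p q r => [c x] [c' y] [c'' z]; apply: le_cinfB.
  have := stepdist_le1 (inr (c, x)) (inr (c'', z)).
  by have := stepdist_ge0 (inr (c', y)) (inr (c'', z)); lra.
move=> r rE r0; rewrite addrC; apply: le_cinfB.
  by have := stepdist_le1 (inr (c, x)) (inr (c'', z)); lra.
move=> s sE s0.
(* Each of the two distances is bounded directly or by a detour. Two direct bounds add up, a direct
   bound turns a detour from the middle point into one from the outer point, and two detours merge
   into one because [c' y u + c' y v] bounds the distance of [u] and [v]. *)
case: rE r0 => [[e /= cc' ->]|[u -> /=]] r0; case: sE s0 => [[e' /= cc'' ->]|[v -> /=]] s0.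
- apply: le_trans (_ : dist x z + (e + e') <= _).
    apply: newdist_le => u v; have := cc' u v; have := cc'' u v.
    by rewrite !ler_norml; lra.
  by have := dist_triangle y x z; lra.
- apply: le_trans (_ : c x v + c'' z v <= _).
    by apply: cinf_le; [right; exists v|rewrite addr_ge0 ?cost_ge0].
  have [? ?] := norm_le (cc' x v); have := cost_lipl c' x y v.
  by lra.
- apply: le_trans (_ : c x u + c'' z u <= _).
    by apply: cinf_le; [right; exists u|rewrite addr_ge0 ?cost_ge0].
  have [? ?] := norm_le (cc'' z u); have := cost_lipl c' z y u; rewrite (distC z).
  by lra.
- apply: le_trans (_ : c x v + c'' z v <= _).
    by apply: cinf_le; [right; exists v|rewrite addr_ge0 ?cost_ge0].
  have := cost_katr c' y u v; have := cost_lipr c x v u.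
  by lra.
Qed.

Lemma stepdist_triangle q p r : stepdist p r <= stepdist p q + stepdist q r.
Proof.
case: p q r => [x|[c x]] [y|[c' y]] [z|[c'' z]].
- exact: dist_triangle.
- exact: tri_llr.
- exact: cost_katr.
- exact: tri_lrr.
- rewrite (stepdistC _ (inl z)) (stepdistC (inr (c, x))) addrC.
  by rewrite (stepdistC (inl y) (inl z)); exact: tri_llr.
- by apply: cinf_le; [right; exists y|rewrite addr_ge0 ?cost_ge0].
- rewrite (stepdistC _ (inl z)) (stepdistC (inr (c, x))) addrC.
  by rewrite (stepdistC (inr (c', y)) (inl z)); exact: tri_lrr.
- exact: tri_rrr.
Qed.

Lemma stepact1 p : stepact 1%g p = p.
Proof.
case: p => [x|[c x]] /=; rewrite gact1//; congr (inr (_, _)).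
apply: biKatetov_ext; apply/funext => u; apply/funext => v /=.
by rewrite invg1 !gact1.
Qed.

Lemma stepactM g h p : stepact (g * h)%g p = stepact g (stepact h p).
Proof.
case: p => [x|[c x]] /=; rewrite gactM//; congr (inr (_, _)).
apply: biKatetov_ext; apply/funext => u; apply/funext => v /=.
by rewrite invgM !gactM.
Qed.

Let stepdist_act_le g p q : stepdist (stepact g p) (stepact g q) <= stepdist p q.
Proof.
case: p q => [x|[c x]] [y|[c' y]] /=; rewrite ?dist_gact ?gactK//.
apply: le_cinf => [|r [[e /= cc' ->]|[u -> /=]] r0]; first exact: cinf_le1.
  rewrite -(dist_gact g x); apply: newdist_le => u v /=.
  exact: cc'.
apply: cinf_le => //; right; exists (gact g u) => /=; by rewrite !gactK.
Qed.

Lemma stepdist_act g p q : stepdist (stepact g p) (stepact g q) = stepdist p q.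
Proof.
apply/eqP; rewrite eq_le stepdist_act_le/=.
by rewrite -{1}(stepact1 p) -{1}(stepact1 q) -(mulVg g) !stepactM stepdist_act_le.
Qed.

(** Here norm-continuity of the orbit of [c] is needed: [(c, x)] moves by at most the displacement
    of [x] plus the uniform displacement of [c]. *)
Lemma stepact_near1 p e : 0 < e ->
  nbhs (1%g : G) [set g | stepdist (stepact g p) p <= e].
Proof.
move=> e0; case: p => [x|[c x]]; first exact: gact_near1.
have e2 : 0 < e / 2 by lra.
apply: filterS2 (gact_near1 x e2) (bikat_act_near1 c e2) => g gx gc.
change (stepdist (inr (bikat_act g c, gact g x)) (inr (c, x)) <= e).
by apply: le_trans (newdist_le _ _ gc) _; move: gx => /=; lra.
Qed.

Definition step : gspace := @GSpace steppt stepdist stepact stepdist_ge0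
  stepdist_le1 stepdistxx stepdistC stepdist_triangle stepdist_act stepact1
  stepactM stepact_near1.

(* The graph of the partial isometry of [step] that [c] adjoins, together with
   the inverse of the one that the transpose of [c] adjoins. *)
Definition stepgraph (c : biKatetov X) (p q : step) : Prop :=
  (exists x, p = inl x /\ q = inr (c, x)) \/
  (exists x, p = inr (bikatT c, x) /\ q = inl x).

Lemma stepgraph_iso c p q p' q' : stepgraph c p q -> stepgraph c p' q' ->
  dist p p' = dist q q'.
Proof.
suff : stepgraph c p q -> stepgraph c p' q' -> stepdist p p' = stepdist q q' by [].
by move=> [[x [-> ->]]|[x [-> ->]]] [[y [-> ->]]|[y [-> ->]]]; rewrite ?stepdist_same.
Qed.

(** Paths from [p] to [q] through the graph. Their capped infimum is the largest bi-Katetov function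
    that vanishes on [stepgraph c]. *)
Definition liftset c (p q : step) : set R :=
  [set r | exists u v, stepgraph c u v /\ r = dist p u + dist v q].

Definition liftcost c (p q : step) : R := cinf (liftset c p q).

Lemma liftcost_le c p q u v : stepgraph c u v -> liftcost c p q <= dist p u + dist v q.
Proof.
by move=> cuv; apply: cinf_le; [exists u, v|rewrite addr_ge0 ?dist_ge0].
Qed.

(** Translate the path. The translate of [(c, x)] is a point over the translated function, at
    distance at most [e] from the copy of [gact g x] over [c], which does lie on the graph. *)
Let liftcost_act_le c g e p q :
    (forall x y, `|bikat_act g c x y - c x y| <= e) ->
  liftcost c (gact g p) (gact g q) <= liftcost c p q + e.
Proof.
move=> gc; have e0 : 0 <= e.
  (* The hypothesis only bounds [e] below at points of [X]; every point of [step] contains one. *)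
  suff [x] : inhabited X by exact: le_trans (gc x x).
  by case: p => [x|[_ x]].
apply: le_cinfB; first by have := cinf_le1 (liftset c (gact g p) (gact g q)); rewrite -/(liftcost _ _ _); lra.
move=> r [u [v [[[x [ux vx]]|[x [ux vx]]] ->]]] _.
  apply: le_trans (liftcost_le (u := inl (gact g x)) (v := inr (c, gact g x)) _ _ _) _.
    by left; exists (gact g x).
  have -> : dist (gact g p) (inl (gact g x) : step) = dist p u.
    by rewrite ux -(dist_gact g p).
  have := dist_triangle (gact g v) (inr (c, gact g x) : step) (gact g q).
  rewrite dist_gact vx.
  have := @newdist_le c (bikat_act g c) (gact g x) (gact g x) e.
  rewrite distxx add0r => /(_ _).
  have gc' x0 y0 : `|c x0 y0 - bikat_act g c x0 y0| <= e by rewrite distrC.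
  by move=> /(_ gc'); rewrite [dist (inr _ : step) _]/dist /=; lra.
apply: le_trans (liftcost_le (u := inr (bikatT c, gact g x)) (v := inl (gact g x)) _ _ _) _.
  by right; exists (gact g x).
have -> : dist (inl (gact g x) : step) (gact g q) = dist v q.
  by rewrite vx -(dist_gact g _ q).
have := dist_triangle (gact g u) (gact g p) (inr (bikatT c, gact g x) : step).
rewrite dist_gact ux.
have := @newdist_le (bikat_act g (bikatT c)) (bikatT c) (gact g x) (gact g x) e.
rewrite distxx add0r => /(_ _).
have gc' x0 y0 : `|bikat_act g (bikatT c) x0 y0 - (bikatT c) x0 y0| <= e.
  exact: gc.
by move=> /(_ gc'); rewrite [dist (inr (bikat_act _ _, _) : step) _]/dist /=; lra.
Qed.

(** The lift again has a norm-continuous orbit, so the construction can be iterated. The two bounds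
    come from [g] and its inverse. *)
Lemma liftcost_near1 c e : 0 < e -> nbhs (1%g : G)
  [set g | forall p q, `|liftcost c (gact g p) (gact g q) - liftcost c p q| <= e].
Proof.
move=> e0; apply: filterS2 (bikat_act_near1 c e0) (nbhs1_inv (bikat_act_near1 c e0)).
move=> g gc gVc p q; have := liftcost_act_le p q gc.
have := liftcost_act_le (gact g p) (gact g q) gVc.
by rewrite !gactK ler_norml; lra.
Qed.

(** The Lipschitz conditions are triangle inequalities; the Katetov conditions hold because the
    graph is isometric, so that two paths through it can be joined. *)
Program Definition bikat_lift (c : biKatetov X) : biKatetov step :=
  @BiKatetov step (liftcost c) _ _ _ _ _ _ (@liftcost_near1 c).
Next Obligation. move=> c x y. exact: cinf_ge0. Qed.
Next Obligation. move=> c x y. exact: cinf_le1. Qed.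
Next Obligation. move=> c x x' y.
rewrite addrC; apply: le_cinfB => [|r [u [v [cuv ->]]] _].
  have := cinf_le1 (liftset c x y); have := dist_ge0 x x'.
  by rewrite -/(liftcost _ _ _); lra.
have := liftcost_le x y cuv; have := dist_triangle x' x u; lra.
Qed.
Next Obligation. move=> c x y y'.
apply: le_cinfB => [|r [u [v [cuv ->]]] _].
  have := cinf_le1 (liftset c x y); have := dist_ge0 y' y.
  by rewrite -/(liftcost _ _ _); lra.
have := liftcost_le x y cuv; have := dist_triangle y' v y; lra.
Qed.
Next Obligation. move=> c x x' y.
apply: le_cinfB => [|r [u [v [cuv ->]]] _].
  have := cinf_ge0 (liftset c x' y); have := dist_le1 x x'.
  by rewrite -/(liftcost _ _ _); lra.
rewrite addrC; apply: le_cinfB => [|s [u' [v' [cuv' ->]]] _].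
  by have := dist_ge0 x u; have := dist_ge0 v y; have := dist_le1 x x'; lra.
have := stepgraph_iso cuv cuv'; have := dist_triangle u x x'.
have := dist_triangle u' u x'; have := dist_triangle y v v'.
by rewrite (distC u' x') (distC y v'); lra.
Qed.
Next Obligation. move=> c x y y'.
apply: le_cinfB => [|r [u [v [cuv ->]]] _].
  have := cinf_ge0 (liftset c x y'); have := dist_le1 y y'.
  by rewrite -/(liftcost _ _ _); lra.
rewrite addrC; apply: le_cinfB => [|s [u' [v' [cuv' ->]]] _].
  by have := dist_ge0 x u; have := dist_ge0 v y; have := dist_le1 y y'; lra.
have := stepgraph_iso cuv cuv'; have := dist_triangle v y y'.
have := dist_triangle v' v y'; have := dist_triangle x u u'.
by rewrite (distC u x) (distC y v); lra.
Qed.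

(** In the next step the copy of [p] over the lift is thus at distance zero from [q]: the new
    isometry extends the old one. *)
Lemma lift_graph c p q : stepgraph c p q -> bikat_lift c p q = 0.
Proof.
move=> cpq; apply/eqP; rewrite eq_le cost_ge0 andbT.
by have := liftcost_le p q cpq; rewrite !distxx addr0.
Qed.

End Step.

End GSpaces.

(** Recursion started at [N], with arbitrary values before. The induction shifts the family [P],
    which avoids transport between types with equal indices. *)
Lemma dependent_extension (P : nat -> Type) (d : forall n, P n)
    (s : forall n, P n -> P n.+1) N (p : P N) :
  exists h : forall n, P n, h N = p /\ forall n, (N <= n)%N -> h n.+1 = s n (h n).
Proof.
elim: N P d s p => [|N IHN] P d s p; first by exists (nat_rect P p s).
have [h [hN hs]] := IHN (fun n => P n.+1) (fun n => d n.+1) (fun n => s n.+1) p.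
exists (fun n => match n return P n with 0%N => d 0%N | m.+1 => h m end); split=> // -[//|n] Nn.
exact: hs.
Qed.

(** * Bi-Katetov functions of finite partial maps *)

Section FinitelySupportedCost.
Variables (R : realType) (G : topologicalGroupType).
Implicit Type X : gspace R G.

Lemma dist0l X (x x' y : X) : dist x x' = 0 -> dist x y = dist x' y.
Proof.
move=> xx'; apply/eqP; rewrite eq_le; have := dist_triangle x' x y.
by have := dist_triangle x x' y; rewrite (distC x' x) xx' !add0r => -> ->.
Qed.

Lemma dist0r X (x y y' : X) : dist y y' = 0 -> dist x y = dist x y'.
Proof. by rewrite !(distC x); exact: dist0l. Qed.

(** For an almost isometric [l], the largest bi-Katetov function whose value at each pair of [l] is
    at most [e]. *)
Definition paircost (T : Type) (d : T -> T -> R) (l : seq (T * T)) (e : R) (x y : T) :=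
  cinf [set r | exists2 p, List.In p l & r = d x p.1 + e + d p.2 y].

(** The factor 2 matches the Katetov conditions: a sum of two costs contains [e] twice, which pays
    for this distortion. *)
Definition almost_iso (T : Type) (d : T -> T -> R) (l : seq (T * T)) (e : R) :=
  0 <= e /\ forall p q, List.In p l -> List.In q l ->
    `|d p.1 q.1 - d p.2 q.2| <= 2 * e.

Lemma paircost_le X (l : seq (X * X)) e x y p : 0 <= e -> List.In p l ->
  paircost (@dist _ _ X) l e x y <= dist x p.1 + e + dist p.2 y.
Proof.
by move=> e0 lp; apply: cinf_le; [by exists p|rewrite !addr_ge0 ?dist_ge0].
Qed.

Lemma near1_seq X (s : seq X) e : 0 < e -> nbhs (1%g : G)
  [set g | forall x, List.In x s -> dist (gact g x) x <= e].
Proof.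
move=> e0; elim: s => [|x s IHs]; first by apply: nearW => g x [].
apply: filterS2 (gact_near1 x e0) IHs => g gx gs y [<-//|]; exact: gs.
Qed.

Section PairCost.
Variables (X : gspace R G) (l : seq (X * X)) (e : R).
Hypothesis le : almost_iso (@dist _ _ X) l e.
Local Notation c := (paircost (@dist _ _ X) l e).

Let e0 : 0 <= e. Proof. by case: le. Qed.

Let norm_le (a b r : R) : `|a - b| <= r -> a <= b + r /\ b <= a + r.
Proof. by rewrite ler_norml; lra. Qed.

(** Only the finitely many points of [l] matter; if [g] moves each by at most [r / 2], each
    candidate sum changes by at most [r]. *)
Let paircost_near1 r : 0 < r -> nbhs (1%g : G)
  [set g | forall x y, `|c (gact g x) (gact g y) - c x y| <= r].
Proof.
move=> r0; have r2 : 0 < r / 2 by lra.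
apply: filterS2 (near1_seq (List.map fst l) r2) (near1_seq (List.map snd l) r2).
move=> g g1 g2 x y; rewrite ler_norml; apply/andP; split.
  suff : c x y <= c (gact g x) (gact g y) + r by lra.
  apply: le_cinfB => [|_ [p lp ->] _].
    by have := cinf_le1 [set r | exists2 p, List.In p l & r = dist x p.1 + e + dist p.2 y]; rewrite -/(c _ _); lra.
  have := g1 _ (List.in_map fst _ _ lp); have := g2 _ (List.in_map snd _ _ lp).
  have := paircost_le x y e0 lp; rewrite -(dist_gact g x) -(dist_gact g _ y).
  have := dist_triangle p.1 (gact g x) (gact g p.1).
  have := dist_triangle p.2 (gact g p.2) (gact g y).
  by rewrite (distC p.1 (gact g p.1)); lra.
suff : c (gact g x) (gact g y) <= c x y + r by lra.
apply: le_cinfB => [|_ [p lp ->] _].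
  by have := cinf_le1 [set r | exists2 p, List.In p l & r = dist (gact g x) p.1 + e + dist p.2 (gact g y)]; rewrite -/(c _ _); lra.
have := g1 _ (List.in_map fst _ _ lp); have := g2 _ (List.in_map snd _ _ lp).
have := paircost_le (gact g x) (gact g y) e0 lp.
rewrite -(dist_gact g x) -(dist_gact g _ y).
have := dist_triangle (gact g p.1) (gact g x) p.1.
have := dist_triangle (gact g p.2) p.2 (gact g y).
by rewrite (distC p.2 (gact g p.2)); lra.
Qed.

Program Definition paircost_biKatetov : biKatetov X :=
  @BiKatetov _ _ X c _ _ _ _ _ _ paircost_near1.
Next Obligation. move=> x y; exact: cinf_ge0. Qed.
Next Obligation. move=> x y; exact: cinf_le1. Qed.
Next Obligation.
move=> x x' y; rewrite addrC; apply: le_cinfB => [|_ [p lp ->] _].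
  have : c x y <= 1 by exact: cinf_le1.
  by have := dist_ge0 x x'; lra.
by have := paircost_le x y e0 lp; have := dist_triangle x' x p.1; lra.
Qed.
Next Obligation.
move=> x y y'; apply: le_cinfB => [|_ [p lp ->] _].
  have : c x y <= 1 by exact: cinf_le1.
  by have := dist_ge0 y' y; lra.
by have := paircost_le x y e0 lp; have := dist_triangle y' p.2 y; lra.
Qed.
Next Obligation.
move=> x x' y; apply: le_cinfB => [|_ [p lp ->] _].
  have : 0 <= c x' y by exact: cinf_ge0.
  by have := dist_le1 x x'; lra.
rewrite addrC; apply: le_cinfB => [|_ [q lq ->] _].
  have := dist_ge0 x p.1; have := dist_ge0 p.2 y; have := dist_le1 x x'.
  by have := e0; lra.
have [? ?] := norm_le (le.2 _ _ lp lq).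
have := dist_triangle p.1 x x'; have := dist_triangle q.1 p.1 x'.
have := dist_triangle y p.2 q.2.
by rewrite (distC q.1 x') (distC y q.2); lra.
Qed.
Next Obligation.
move=> x y y'; apply: le_cinfB => [|_ [p lp ->] _].
  have : 0 <= c x y' by exact: cinf_ge0.
  by have := dist_le1 y y'; lra.
rewrite addrC; apply: le_cinfB => [|_ [q lq ->] _].
  have := dist_ge0 x p.1; have := dist_ge0 p.2 y; have := dist_le1 y y'.
  by have := e0; lra.
have [? ?] := norm_le (le.2 _ _ lp lq).
have := dist_triangle p.2 y y'; have := dist_triangle q.2 p.2 y'.
have := dist_triangle x p.1 q.1.
by rewrite (distC p.1 x) (distC y p.2); lra.
Qed.

End PairCost.
End FinitelySupportedCost.

(** * The direct limit of the tower of steps *)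

Section Limit.
Variables (R : realType) (G : topologicalGroupType) (X0 : gspace R G).

Fixpoint tower (n : nat) : gspace R G :=
  if n is m.+1 then step (tower m) else X0.

(** A point of the limit has a value at every stage, which avoids coercions between stages; values
    below [level] are junk. From there on compatibility is up to distance zero only, as a lifted
    isometry agrees with the previous one only in this sense. *)
Record thread := Thread {
  stage :> forall n, tower n;
  level : nat;
  threadP : forall n, (level <= n)%N ->
    dist (stage n.+1) (inl (stage n) : tower n.+1) = 0
}.

Definition thread_dist (x y : thread) : R :=
  dist (x (maxn (level x) (level y))) (y (maxn (level x) (level y))).

(** Beyond both levels the distance no longer depends on the stage. *)
Lemma thread_distE n (x y : thread) : (level x <= n)%N -> (level y <= n)%N ->
  thread_dist x y = dist (x n) (y n).
Proof.
move=> xn yn; have : (maxn (level x) (level y) <= n)%N by rewrite geq_max xn.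
rewrite /thread_dist; set m := maxn _ _ => mn; rewrite -(subnKC mn).
have xm : (level x <= m)%N by rewrite leq_maxl.
have ym : (level y <= m)%N by rewrite leq_maxr.
elim: (n - m)%N => [|k ->]; first by rewrite addn0.
have xk : (level x <= m + k)%N by rewrite (leq_trans xm)// leq_addr.
have yk : (level y <= m + k)%N by rewrite (leq_trans ym)// leq_addr.
by rewrite addnS (dist0l _ (threadP xk)) (dist0r _ (threadP yk)).
Qed.

Program Definition thread_act (g : G) (x : thread) : thread :=
  @Thread (fun n => gact g (x n)) (level x) _.
Next Obligation.
move=> g x n xn /=; rewrite -[RHS](threadP xn) -(dist_gact g (x n.+1)).
by [].
Qed.

Lemma thread_ext (x y : thread) : (forall n, x n = y n) -> level x = level y -> x = y.
Proof.
case: x y => [x k p] [y j q] /= xy kj.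
have {}xy : x = y by exact: functional_extensionality_dep.
by subst y j; congr Thread; exact: Prop_irrelevance.
Qed.

Program Definition limit : gspace R G :=
  @GSpace _ _ thread thread_dist thread_act _ _ _ _ _ _ _ _ _.
Next Obligation. by move=> x y; exact: dist_ge0. Qed.
Next Obligation. by move=> x y; exact: dist_le1. Qed.
Next Obligation. by move=> x; exact: distxx. Qed.
Next Obligation. by move=> x y; rewrite /thread_dist maxnC distC. Qed.
Next Obligation.
move=> y x z; set n := maxn (level x) (maxn (level y) (level z)).
have xn : (level x <= n)%N by rewrite leq_maxl.
have yn : (level y <= n)%N by rewrite leq_max leq_maxl orbT.
have zn : (level z <= n)%N by rewrite leq_max leq_maxr orbT.
by rewrite !(@thread_distE n)//; exact: dist_triangle.
Qed.
Next Obligation. by move=> g x y; exact: dist_gact. Qed.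
Next Obligation. by move=> x; apply: thread_ext => // n; exact: gact1. Qed.
Next Obligation. by move=> g h x; apply: thread_ext => // n; exact: gactM. Qed.
Next Obligation. by move=> x e e0; exact: (gact_near1 (x (maxn (level x) (level x)))). Qed.

Program Definition base_thread (x : X0) : limit :=
  @Thread (nat_rect tower x (fun n y => inl y : tower n.+1)) 0 _.
Next Obligation. by move=> x n _; exact: distxx. Qed.

End Limit.

(* Inverses only hold up to distance zero. *)
Record selfisometry (R : realType) (G : topologicalGroupType) (X : gspace R G) :=
  SelfIsometry {
  fwd :> X -> X;
  bwd : X -> X;
  fwd_iso : forall x y, dist (fwd x) (fwd y) = dist x y;
  fwdK : forall x, dist (bwd (fwd x)) x = 0;
  bwdK : forall x, dist (fwd (bwd x)) x = 0
}.

Section LimitIsometries.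
Variables (R : realType) (G : topologicalGroupType) (X0 : gspace R G).
Local Notation tower := (tower X0).
Variables (h : forall n, biKatetov (tower n)) (N : nat).
Hypothesis hlift : forall n, (N <= n)%N -> h n.+1 = bikat_lift (h n).

(** The isometry described by the coherent sequence [h]: at each stage take the copy adjoined over
    [h m]. The copies are compatible because [h m.+1] lifts [h m]; stage 0 has no copies, so its
    value is junk. *)
Program Definition expand (x : limit X0) : limit X0 :=
  @Thread _ _ X0 (fun n => match n return tower n with 0%N => x 0%N | m.+1 => inr (h m, x m) end)
    (maxn N (level x)).+1 _.
Next Obligation.
move=> x [//|n]; rewrite ltnS geq_max => /andP[Nn xn].
change (h n.+1 (x n.+1) (inr (h n, x n) : tower n.+1) = 0).
apply/eqP; rewrite eq_le cost_ge0 andbT.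
apply: le_trans (cost_lipl _ _ (inl (x n) : tower n.+1) _) _.
rewrite threadP// add0r hlift// lift_graph//.
by left; exists (x n).
Qed.

(** The inverse, obtained from the transposes through the second half of [stepgraph]. *)
Program Definition contract (x : limit X0) : limit X0 :=
  @Thread _ _ X0 (fun n => match n return tower n with 0%N => x 0%N | m.+1 => inr (bikatT (h m), x m) end)
    (maxn N (level x)).+1 _.
Next Obligation.
move=> x [//|n]; rewrite ltnS geq_max => /andP[Nn xn].
change (h n.+1 (inr (bikatT (h n), x n) : tower n.+1) (x n.+1) = 0).
apply/eqP; rewrite eq_le cost_ge0 andbT.
apply: le_trans (cost_lipr _ _ _ (inl (x n) : tower n.+1)) _.
rewrite (distC (inl _ : tower n.+1)) threadP// addr0 hlift// lift_graph//.
by right; exists (x n).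
Qed.

Lemma expand_iso (x y : limit X0) : dist (expand x) (expand y) = dist x y.
Proof.
set n := maxn N (maxn (level x) (level y)).
have Nn : (N <= n)%N by rewrite leq_maxl.
have xn : (level x <= n)%N by rewrite leq_max leq_maxl orbT.
have yn : (level y <= n)%N by rewrite leq_max leq_maxr orbT.
rewrite [LHS](@thread_distE _ _ _ n.+1) ?[RHS](@thread_distE _ _ _ n)//=.
- exact: stepdist_same.
- by rewrite ltnS geq_max Nn.
- by rewrite ltnS geq_max Nn.
Qed.

Lemma contractK (x : limit X0) : dist (expand (contract x)) x = 0.
Proof.
set n := maxn N (level x).
have Nn : (N <= n)%N by rewrite leq_maxl.
have xn : (level x <= n)%N by rewrite leq_maxr.
(* Two copies are taken in succession, so the comparison is made two stages later. The distance
   there is a value of [h n.+1] at a pair of the graph of [h n]. *)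
rewrite [LHS](@thread_distE _ _ _ n.+2).
- rewrite (dist0r _ (threadP _)) 1?ltnW//.
  change (h n.+1 (inr (bikatT (h n), x n) : tower n.+1) (x n.+1) = 0).
  apply/eqP; rewrite eq_le cost_ge0 andbT.
  apply: le_trans (cost_lipr _ _ _ (inl (x n) : tower n.+1)) _.
  rewrite (distC (inl _ : tower n.+1)) threadP// addr0 hlift// lift_graph//.
  by right; exists (x n).
- by rewrite ltnS geq_max (leq_trans Nn)//=.
- by rewrite (leq_trans xn)// -addn2 leq_addr.
Qed.

Lemma expandK (x : limit X0) : dist (contract (expand x)) x = 0.
Proof.
set n := maxn N (level x).
have Nn : (N <= n)%N by rewrite leq_maxl.
have xn : (level x <= n)%N by rewrite leq_maxr.
rewrite [LHS](@thread_distE _ _ _ n.+2).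
- rewrite (dist0r _ (threadP _)) 1?ltnW//.
  change (h n.+1 (x n.+1) (inr (h n, x n) : tower n.+1) = 0).
  apply/eqP; rewrite eq_le cost_ge0 andbT.
  apply: le_trans (cost_lipl _ _ (inl (x n) : tower n.+1) _) _.
  rewrite threadP// add0r hlift// lift_graph//.
  by left; exists (x n).
- by rewrite ltnS geq_max (leq_trans Nn)//=.
- by rewrite (leq_trans xn)// -addn2 leq_addr.
Qed.

Definition expand_isometry : selfisometry (limit X0) :=
  SelfIsometry expand_iso expandK contractK.

Lemma expand_dist (x y : limit X0) : (level x <= N)%N -> (level y <= N)%N ->
  dist (expand x) y = h N (x N) (y N).
Proof.
move=> xN yN; rewrite [LHS](@thread_distE _ _ _ N.+1).
- by rewrite (dist0r _ (threadP _)).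
- by rewrite ltnS geq_max leqnn.
- exact: leqW.
Qed.

End LimitIsometries.

Section LimitRealization.
Variables (R : realType) (G : topologicalGroupType) (X0 : gspace R G).
Local Notation Y := (limit X0).

Lemma level_bound (s : seq Y) : exists N, forall x, List.In x s -> (level x <= N)%N.
Proof.
elim: s => [|x s [N sN]]; first by exists 0%N.
exists (maxn (level x) N) => y [<-|ys]; first exact: leq_maxl.
by rewrite leq_max sN ?orbT.
Qed.

(** Past the levels of all points involved, [l] and [F] live in one stage of the tower. The cost
    function of [l] there is lifted to all later stages, and the resulting isometry has exactly the
    prescribed distances on [F]. *)
Lemma limit_realization (l : seq (Y * Y)) e (F : seq Y) :
  almost_iso (@dist _ _ Y) l e -> exists f : selfisometry Y,
  forall x y, List.In x F -> List.In y F -> dist (f x) y = paircost (@dist _ _ Y) l e x y.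
Proof.
move=> [e0 le].
have [N1 FN1] := level_bound F.
have [N2 lN2] := level_bound (List.map fst l).
have [N3 lN3] := level_bound (List.map snd l).
set N := maxn N1 (maxn N2 N3).
have FN x : List.In x F -> (level x <= N)%N.
  by move=> xF; rewrite (leq_trans (FN1 _ xF))// leq_maxl.
have lfN p : List.In p l -> (level p.1 <= N)%N.
  move=> pl; rewrite (leq_trans (lN2 _ (List.in_map fst _ _ pl)))//.
  by rewrite leq_max leq_maxl orbT.
have lsN p : List.In p l -> (level p.2 <= N)%N.
  move=> pl; rewrite (leq_trans (lN3 _ (List.in_map snd _ _ pl)))//.
  by rewrite leq_max leq_maxr orbT.
have dE (a b : Y) : (level a <= N)%N -> (level b <= N)%N -> thread_dist a b = dist (a N) (b N).
  exact: thread_distE.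
pose lN : seq (tower X0 N * tower X0 N) := List.map (fun p : Y * Y => (p.1 N, p.2 N)) l.
have lNe : almost_iso (@dist _ _ (tower X0 N)) lN e.
  split=> // p q /List.in_map_iff[p' [<- pl]] /List.in_map_iff[q' [<- ql]] /=.
  have := le p' q' pl ql; rewrite [dist p'.1 _](@thread_distE _ _ _ N) ?lfN//.
  by rewrite [dist p'.2 _](@thread_distE _ _ _ N) ?lsN.
(* The constant cost function 1 fills the stages before [N]. *)
have [h [hN hs]] := dependent_extension (fun n => bikat1 (tower X0 n))
  (fun n => @bikat_lift _ _ (tower X0 n)) (paircost_biKatetov lNe).
exists (expand_isometry hs) => x y xF yF.
rewrite expand_dist ?FN// hN /=; congr cinf; apply/seteqP; split=> r [p].
  move=> /List.in_map_iff[q [<- ql]] ->; exists q => //.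
  by rewrite (dE x q.1 (FN _ xF) (lfN _ ql)) (dE q.2 y (lsN _ ql) (FN _ yF)).
move=> pl ->; exists (p.1 N, p.2 N) => /=.
  by apply/List.in_map_iff; exists p.
by rewrite (dE x p.1 (FN _ xF) (lfN _ pl)) (dE p.2 y (lsN _ pl) (FN _ yF)).
Qed.

End LimitRealization.

(** * Right uniformly continuous functions *)

Section RightUniformlyContinuous.
Variables (R : realType) (G : topologicalGroupType).
Local Open Scope group_scope.

Definition right_ucont (f : G -> R) := unit_valued f /\
  forall e : R, (0 < e)%R ->
    nbhs (1 : G) [set u : G | forall z : G, (`|f (u * z)%g - f z| <= e)%R].

Section Separation.
Variables (E : set (right_uniform G * right_uniform G)) (entE : entourage E) (r : R).
Hypothesis r0 : (0 < r)%R.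
Local Notation T := [the pseudoMetricType R of gauge.type entE].
Hypothesis rE : forall x y : T, ball x r y -> E (x, y).

(** The distance from 1 in the gauge pseudometric of [E], scaled by [r] and capped at 1. *)
Let f (z : G) : R :=
  cinf [set a | exists2 e, (0 < e)%R /\ ball ((1 : G) : T) e (z : T) & (a = e / r)%R].

Let fle x e z : (0 < e)%R -> ball (x : T) e (z : T) -> (f z <= f x + e / r)%R.
Proof.
move=> e0 xz; have er : (0 < e / r)%R by rewrite divr_gt0.
apply: le_cinfB => [|_ [a [a0 ax] ->] _].
  have : (f z <= 1)%R by exact: cinf_le1.
  by lra.
rewrite -mulrDl; apply: cinf_le; last by rewrite divr_ge0// ltW// addr_gt0.
by exists (a + e)%R => //; split; [rewrite addr_gt0|exact: ball_triangle ax xz].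
Qed.

Lemma gauge_right_ucont : exists f : G -> R,
  [/\ right_ucont f, (f 1%g = 0)%R & forall z, ~ E (1, z) -> f z = 1%R].
Proof.
exists f; split; [split| |].
- by move=> z; rewrite cinf_ge0 cinf_le1.
- move=> e e0; have er0 : (0 < e * r)%R by rewrite mulr_gt0.
  have : @entourage T [set xy | ball xy.1 (e * r)%R xy.2].
    by rewrite -entourage_ballE; exists (e * r)%R.
  (* Gauge entourages belong to the right uniformity, hence contain [(z, u * z)] for all [z] when
     [u] is close to 1. *)
  move=> /(gauge.gauge_ent entE)[V V1 VE]; apply: filterS V1 => u Vu z.
  have zuz : ball (z : T) (e * r)%R ((u * z : G) : T).
    by apply: (VE (z, u * z)) => /=; rewrite mulgK.
  have := fle er0 zuz; have := fle er0 (ball_sym zuz).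
  by rewrite mulfK ?gt_eqF// ler_norml; lra.
- apply/eqP; rewrite eq_le cinf_ge0 andbT; apply/ler_addgt0Pr => e e0.
  rewrite add0r; apply: cinf_le; last exact: ltW.
  exists (e * r)%R; last by rewrite mulfK ?gt_eqF.
  by split; [rewrite mulr_gt0|apply: ballxx; rewrite mulr_gt0].
- move=> z nEz; apply/eqP; rewrite eq_le cinf_le1/=.
  apply: le_cinf => // _ [e [e0 ez] ->] _; rewrite ler_pdivlMr// mul1r leNgt.
  by apply/negP => er; apply/nEz/rE; exact: le_ball (ltW er) _ ez.
Qed.

End Separation.

Lemma right_ucont_separation (U : set G) : nbhs (1 : G) U -> exists f : G -> R,
  [/\ right_ucont f, (f 1%g = 0)%R & forall z, ~ U z -> f z = 1%R].
Proof.
move=> U1; pose E : set (right_uniform G * right_uniform G) :=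
  [set xy | U (xy.2 * xy.1^-1)].
have entE : @entourage (right_uniform G) E by exists U.
have : @entourage [the pseudoMetricType R of gauge.type entE] E.
  by exists 0%N => //= xy [].
rewrite -entourage_ballE => -[r r0 rE].
have [|f [fu f1 fE]] := @gauge_right_ucont E entE r r0.
  by move=> x y xy; exact: rE.
exists f; split=> // z nUz; apply: fE => /=.
by rewrite /E /= invg1 mulg1.
Qed.

Definition rucfun := {f : G -> R | right_ucont f}.

Program Definition rucfun_act (g : G) (f : rucfun) : rucfun :=
  exist _ (fun z => sval f (g^-1 * z)) _.
Next Obligation.
move=> g [f [f1 fu]]; split=> [z|e e0]; first exact: f1.
apply: filterS (nbhs1_conjg g (fu _ e0)) => u fue z /=.
by have := fue (g^-1 * z); rewrite !mulgA mulgK.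
Qed.

Let rucfun_eq (f h : rucfun) : sval f =1 sval h -> f = h.
Proof.
case: f h => [f fu] [h hu] /= /funext fh; subst h.
by congr exist; exact: Prop_irrelevance.
Qed.

Program Definition ruc_gspace : gspace R G :=
  @GSpace R G rucfun (fun f h => supdist (sval f) (sval h)) rucfun_act
    _ _ _ _ _ _ _ _ _.
Next Obligation. by move=> f h; exact: supdist_ge0. Qed.
Next Obligation. by move=> f h; exact: supdist_le1. Qed.
Next Obligation. by move=> f; exact: supdistxx. Qed.
Next Obligation. by move=> f h; exact: supdistC. Qed.
Next Obligation.
by move=> h f k; apply: supdist_triangle; [exact: (svalP f).1|exact: (svalP h).1|exact: (svalP k).1].
Qed.
Next Obligation.
move=> g f h; congr cinf; apply/seteqP; split=> e /= fhe z; last exact: fhe.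
by have := fhe (g * z); rewrite mulKg.
Qed.
Next Obligation. by move=> f; apply: rucfun_eq => z /=; rewrite invg1 mul1g. Qed.
Next Obligation. by move=> g h f; apply: rucfun_eq => z /=; rewrite invgM mulgA. Qed.
Next Obligation.
move=> f e e0; apply: filterS (nbhs1_inv ((svalP f).2 _ e0)) => g fg.
by apply: supdist_le; [exact: ltW|exact: fg].
Qed.

(** Evaluate the translate of [f] and [f] at [g]: outside [U] the values are [f 1] and [f g], that
    is 0 and 1. So the action on the initial space determines the topology of [G]. *)
Lemma rucfun_separation (U : set G) : nbhs (1 : G) U ->
  exists f : ruc_gspace, forall g, (dist (gact g f) f < 1)%R -> U g.
Proof.
move=> /right_ucont_separation[f [fu f1 fU]]; exists (exist _ f fu) => g.
apply: contraPP => /fU fg; apply/negP; rewrite -leNgt.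
have := @le_supdist R _ (fun z => f (g^-1 * z)) f g.
rewrite mulVg f1 fg sub0r normrN normr1; exact.
Qed.

End RightUniformlyContinuous.

(** * Small dense subsets and completion *)

(** Cardinality at most that of [K], expressed by an enumeration. The two hypotheses on [K] below
    replace cardinal arithmetic. *)
Definition small (K T : Type) := exists s : K -> T, forall t, exists k, s k = t.

Section Small.
Variable K : Type.
Hypotheses (smallKK : small K (K * K)) (small_nat : small K nat).

Lemma small_id : small K K. Proof. by exists id => k; exists k. Qed.

Lemma small_surj (T U : Type) (f : T -> U) :
  small K T -> (forall u, exists t, f t = u) -> small K U.
Proof.
move=> [s sT] fU; exists (f \o s) => u; have [t <-] := fU u.
by have [k <-] := sT t; exists k.
Qed.

Lemma small_prod T U : small K T -> small K U -> small K (T * U).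
Proof.
move=> [s sT] [s' sU]; apply: (small_surj (f := fun p => (s p.1, s' p.2)) smallKK).
by move=> [t u]; have [k <-] := sT t; have [k' <-] := sU u; exists (k, k').
Qed.

Lemma small_sum T U : small K T -> small K U -> small K (T + U).
Proof.
move=> [s sT] [s' sU].
apply: (@small_surj (nat * K) _ (fun p => if p.1 is 0%N then inl (s p.2) else inr (s' p.2))).
  exact: small_prod small_nat small_id.
move=> [t|u]; first by have [k <-] := sT t; exists (0%N, k).
by have [k <-] := sU u; exists (1%N, k).
Qed.

Lemma small_seq T : small K T -> small K (seq T).
Proof.
move=> [s sT]; have [p pP] := smallKK.
(* A list of length [n] is read off [k] by unpairing [n] times. *)
pose dec := fix dec n k :=
  if n is m.+1 then s (p k).1 :: dec m (p k).2 else [::].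
apply: (@small_surj (nat * K) _ (fun q => dec q.1 q.2)).
  exact: small_prod small_nat small_id.
elim=> [|t l [[n k] /= <-]].
  by have [s0 /(_ 0%N)[k0 _]] := small_nat; exists (0%N, k0).
have [k1 <-] := sT t; have [k2 k2E] := pP (k1, k).
by exists (n.+1, k2); rewrite /= k2E.
Qed.

Lemma small_count (T : countType) (t0 : T) : small K T.
Proof.
apply: (@small_surj nat T (fun n => odflt t0 (choice.unpickle n)) small_nat) => t.
by exists (choice.pickle t); rewrite choice.pickleK.
Qed.

End Small.

(** * A small subset closed under the realizing isometries *)

Section LowenheimSkolem.
Variables (R : realType) (G : topologicalGroupType) (Y : gspace R G) (K : Type).
Hypotheses (smallKK : small K (K * K)) (small_nat : small K nat).
Hypothesis realization : forall (l : seq (Y * Y)) e (F : seq Y),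
  almost_iso (@dist _ _ Y) l e -> exists f : selfisometry Y,
  forall x y, List.In x F -> List.In y F -> dist (f x) y = paircost (@dist _ _ Y) l e x y.
Variables (e0 : K -> Y) (g0 : K -> G).

Definition id_selfisometry : selfisometry Y :=
  @SelfIsometry _ _ Y id id (fun _ _ => erefl) (@distxx _ _ Y) (@distxx _ _ Y).

(** A Skolem function: one fixed isometry for each finite realization problem, the identity for
    insoluble ones. *)
Let realizer : exists tau : seq (Y * Y) -> R -> seq Y -> selfisometry Y,
  forall l e F, almost_iso (@dist _ _ Y) l e ->
  forall x y, List.In x F -> List.In y F ->
    dist (tau l e F x) y = paircost (@dist _ _ Y) l e x y.
Proof.
have : forall p : seq (Y * Y) * R * seq Y, exists f : selfisometry Y,
    almost_iso (@dist _ _ Y) p.1.1 p.1.2 ->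
    forall x y, List.In x p.2 -> List.In y p.2 ->
    dist (f x) y = paircost (@dist _ _ Y) p.1.1 p.1.2 x y.
  move=> [[l e] F] /=; have [le|nle] := pselect (almost_iso (@dist _ _ Y) l e).
    by have [f fP] := realization F le; exists f.
  by exists id_selfisometry.
by move=> /choice[tau tauP]; exists (fun l e F => tau (l, e, F)) => l e F; exact: (tauP (l, e, F)).
Qed.

(** The operations to close under: keep a point, translate it by some [g0 k], or apply the chosen
    isometry of a problem or its inverse, as the boolean says. Errors are rational to keep the codes
    few. *)
Let code := (K + (K * K) + (seq (K * K) * rat * seq K * K * bool))%type.

Let small_code : small K code.
Proof.
apply: small_sum => //; first by apply: small_sum => //; exact: small_id.
apply: small_prod => //; last exact: (small_count small_nat true).
apply: small_prod => //; last exact: small_id.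
apply: small_prod => //; last exact/small_seq/small_id.
apply: small_prod => //; last exact: (small_count small_nat (0 : rat)).
exact: small_seq.
Qed.

Lemma lowenheim_skolem : exists D : K -> Y,
  [/\ forall k, exists k', D k' = e0 k,
      forall k k', exists k'', D k'' = gact (g0 k) (D k') &
      forall (l : seq (K * K)) (q : rat) (F : seq K),
        let l' := List.map (fun p => (D p.1, D p.2)) l in
        almost_iso (@dist _ _ Y) l' (ratr q) ->
        exists f : selfisometry Y,
        [/\ forall k k', List.In k F -> List.In k' F ->
              dist (f (D k)) (D k') = paircost (@dist _ _ Y) l' (ratr q) (D k) (D k'),
            forall k, exists k', D k' = f (D k) &
            forall k, exists k', D k' = bwd f (D k)]].
Proof.
have [tau tauP] := realizer; have [s sP] := small_code.
pose decode (E : K -> Y) (w : code) : Y :=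
  match w with
  | inl (inl k) => E k
  | inl (inr p) => gact (g0 p.1) (E p.2)
  | inr (l, q, F, k, b) =>
      let f := tau (List.map (fun p => (E p.1, E p.2)) l) (ratr q) (List.map E F) in
      if b then f (E k) else bwd f (E k)
  end.
(* Stage [n.+1] enumerates the results of all operations on stage [n]; [D] enumerates the union of
   the stages. *)
pose E := fix E n := if n is m.+1 then decode (E m) \o s else e0.
have EP n w : exists k, E n.+1 k = decode (E n) w.
  by have [k <-] := sP w; exists k.
have Emono n m k : exists k', E (m + n)%N k' = E n k.
  elim: m => [|m [k' k'E]]; first by exists k.
  by have [k'' k''E] := EP (m + n)%N (inl (inl k')); exists k''; rewrite -k'E; exact: k''E.
have Ele n m k : (n <= m)%N -> exists k', E m k' = E n k.
  by move=> nm; have [k' <-] := Emono n (m - n)%N k; exists k'; rewrite subnK.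
have [d dP] := small_prod smallKK small_nat (small_id K).
pose D k := E (d k).1 (d k).2.
have DE n k : exists k', D k' = E n k.
  by have [k' k'E] := dP (n, k); exists k'; rewrite /D k'E.
have Dbound (F : seq K) : exists n, forall k, List.In k F -> exists k', E n k' = D k.
  elim: F => [|k F [n nF]]; first by exists 0%N.
  exists (maxn n (d k).1) => k' [<-|k'F]; first by apply: Ele; exact: leq_maxr.
  by have [k'' <-] := nF _ k'F; apply: Ele; exact: leq_maxl.
have Dlist (F : seq K) n : (forall k, List.In k F -> exists k', E n k' = D k) ->
    exists F', List.map (E n) F' = List.map D F.
  elim: F => [|k F IHF] nF; first by exists [::].
  have [F' F'E] := IHF (fun k' k'F => nF k' (or_intror k'F)).
  by have [k' k'E] := nF k (or_introl erefl); exists (k' :: F'); rewrite /= k'E F'E.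
have Dplist (l : seq (K * K)) n :
    (forall k, List.In k (List.map fst l) -> exists k', E n k' = D k) ->
    (forall k, List.In k (List.map snd l) -> exists k', E n k' = D k) ->
    exists l', List.map (fun p => (E n p.1, E n p.2)) l' = List.map (fun p => (D p.1, D p.2)) l.
  elim: l => [|[k1 k2] l IHl] nf ns; first by exists [::].
  have [l' l'E] := IHl (fun k' k'F => nf k' (or_intror k'F)) (fun k' k'F => ns k' (or_intror k'F)).
  have [k1' k1E] := nf k1 (or_introl erefl); have [k2' k2E] := ns k2 (or_introl erefl).
  by exists ((k1', k2') :: l'); rewrite /= k1E k2E l'E.
exists D; split.
- by move=> k; exact: (DE 0%N k).
- move=> k k'; have [k'' k''E] := EP (d k').1 (inl (inr (k, (d k').2))).
  by have [k3 k3E] := DE (d k').1.+1 k''; exists k3; rewrite k3E; exact: k''E.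
move=> l q F l' l'iso.
have [n1 n1P] := Dbound F; have [n2 n2P] := Dbound (List.map fst l).
have [n3 n3P] := Dbound (List.map snd l).
set n := maxn n1 (maxn n2 n3).
have up m (F' : seq K) : (m <= n)%N ->
    (forall k, List.In k F' -> exists k', E m k' = D k) ->
    forall k, List.In k F' -> exists k', E n k' = D k.
  by move=> mn mF k kF; have [k' <-] := mF _ kF; exact: Ele.
have n1n : (n1 <= n)%N by rewrite leq_maxl.
have n2n : (n2 <= n)%N by rewrite leq_max leq_maxl orbT.
have n3n : (n3 <= n)%N by rewrite leq_max leq_maxr orbT.
(* The chosen isometry depends only on the points in the lists. These can be recoded at any late
   stage [m], so one and the same isometry maps every [D k] into the union. *)
have closed b k : exists k', D k' =
    if b then tau l' (ratr q) (List.map D F) (D k) else bwd (tau l' (ratr q) (List.map D F)) (D k).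
  set m := maxn n (d k).1.
  have nm : (n <= m)%N by rewrite leq_maxl.
  have upm (F' : seq K) : (forall k, List.In k F' -> exists k', E n k' = D k) ->
      forall k, List.In k F' -> exists k', E m k' = D k.
    by move=> mF k1 kF; have [k' <-] := mF _ kF; exact: Ele.
  have [F' F'E] := Dlist F m (upm _ (up _ _ n1n n1P)).
  have [l'' l''E] := Dplist l m (upm _ (up _ _ n2n n2P)) (upm _ (up _ _ n3n n3P)).
  have [k' k'E] : exists k', E m k' = D k by apply: Ele; exact: leq_maxr.
  have [k1 k1E] := EP m (inr (l'', q, F', k', b)).
  have [k2 k2E] := DE m.+1 k1; exists k2; rewrite k2E k1E /= F'E l''E k'E.
  by case: b {k1E}.
exists (tau l' (ratr q) (List.map D F)); split.
- by move=> k k' kF k'F; apply: tauP => //; exact: List.in_map.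
- by move=> k; exact: (closed true).
- by move=> k; exact: (closed false).
Qed.

End LowenheimSkolem.

Lemma paircost_leB (R : realType) (T T' : Type) (d : T -> T -> R)
    (d' : T' -> T' -> R) (l : seq (T * T)) (l' : seq (T' * T')) e e' x y x' y' r :
  0 <= r ->
  (forall p, List.In p l -> exists2 p', List.In p' l' &
     0 <= d' x' p'.1 + e' + d' p'.2 y' <= d x p.1 + e + d p.2 y + r) ->
  paircost d' l' e' x' y' <= paircost d l e x y + r.
Proof.
move=> r0 ll'; apply: le_cinfB => [|_ [p lp ->] _].
  have : paircost d' l' e' x' y' <= 1 by exact: cinf_le1.
  by lra.
have [p' lp' /andP[p'0 pp']] := ll' _ lp; apply: le_trans pp'.
by apply: cinf_le => //; exists p'.
Qed.

(** * The completion as a space of distance functions *)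

Section Completion.
Variables (R : realType) (G : topologicalGroupType) (Y : gspace R G) (K : Type).
Variables (D : K -> Y) (g0 : K -> G).
Hypothesis g0_dense : forall (g : G) (U : set G), nbhs (1%g : G) U ->
  exists k, U (g0 k * g^-1)%g.
Hypothesis D_act : forall k k', exists k'', D k'' = gact (g0 k) (D k').
Hypothesis D_realization : forall (l : seq (K * K)) (q : rat) (F : seq K),
  let l' := List.map (fun p => (D p.1, D p.2)) l in
  almost_iso (@dist _ _ Y) l' (ratr q) ->
  exists f : selfisometry Y,
  [/\ forall k k', List.In k F -> List.In k' F ->
        dist (f (D k)) (D k') = paircost (@dist _ _ Y) l' (ratr q) (D k) (D k'),
      forall k, exists k', D k' = f (D k) &
      forall k, exists k', D k' = bwd f (D k)].

(** Kuratowski embedding: points of the completion are the uniform limits of distance functions of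
    points [D k]. Being functions, they are separated automatically. *)
Definition adherent (m : Y -> R) := unit_valued m /\
  forall e, 0 < e -> exists k, forall y, `|m y - dist (D k) y| <= e.

Definition completion_point := {m : Y -> R | adherent m}.
Implicit Types (m n : completion_point) (y : Y).

Let cdist m n : R := supdist (sval m) (sval n).

Lemma completion_ext m n : sval m =1 sval n -> m = n.
Proof.
case: m n => [m mP] [n nP] /= /funext mn; subst n.
by congr exist; exact: Prop_irrelevance.
Qed.

Lemma adherent_lip m y y' : sval m y <= sval m y' + dist y y'.
Proof.
apply/ler_addgt0Pr => e e0; have e2 : 0 < e / 2 by lra.
have [k mk] := (svalP m).2 _ e2; have := mk y; have := mk y'.
have := dist_triangle y' (D k) y; rewrite (distC y' y) !ler_norml; lra.
Qed.

Lemma adherent0 m y y' : dist y y' = 0 -> sval m y = sval m y'.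
Proof.
move=> yy'; apply/eqP; rewrite eq_le; have := adherent_lip m y y'.
by have := adherent_lip m y' y; rewrite distC yy' !addr0 => -> ->.
Qed.

Lemma adherent_comp (b : Y -> Y) m :
  (forall k e, 0 < e -> exists k', forall y, `|dist (D k) (b y) - dist (D k') y| <= e) ->
  adherent (fun y => sval m (b y)).
Proof.
move=> bD; split=> [y|e e0]; first exact: (svalP m).1.
have e2 : 0 < e / 2 by lra.
have [k mk] := (svalP m).2 _ e2; have [k' kk'] := bD k _ e2.
by exists k' => y; have := mk (b y); have := kk' y; rewrite !ler_norml; lra.
Qed.

(** The set [D] is invariant only under the dense family [g0]; the translate of [D k] by [g] is
    approximated by one by some [g0 k1]. *)
Let act_approx g k e : 0 < e -> exists k', forall y,
  `|dist (D k) (gact g^-1%g y) - dist (D k') y| <= e.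
Proof.
move=> e0; have [k1 k1e] := g0_dense g (gact_near1 (gact g (D k)) e0).
have [k2 k2E] := D_act k1 k; exists k2 => y.
rewrite -(dist_gact g (D k)) gactKV k2E.
move: k1e; rewrite /= gactM gactK => k1e.
have := dist_triangle (gact g (D k)) (gact (g0 k1) (D k)) y.
have := dist_triangle (gact (g0 k1) (D k)) (gact g (D k)) y.
by rewrite (distC (gact g (D k)) (gact (g0 k1) (D k))) ler_norml; lra.
Qed.

Definition completion_act (g : G) m : completion_point :=
  exist _ (fun y => sval m (gact g^-1%g y)) (adherent_comp m (act_approx g)).

Program Definition hat k : completion_point := exist _ (dist (D k)) _.
Next Obligation.
move=> k; split=> [y|e e0]; first by rewrite dist_ge0 dist_le1.
by exists k => y; rewrite subrr normr0 ltW.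
Qed.

(** The triangle inequality bounds the supremum, which is attained at [D k']. *)
Lemma hat_dist k k' : cdist (hat k) (hat k') = dist (D k) (D k').
Proof.
apply/eqP; rewrite eq_le; apply/andP; split.
  apply: supdist_le; first exact: dist_ge0.
  move=> y /=; have := dist_triangle (D k) (D k') y.
  by have := dist_triangle (D k') (D k) y; rewrite (distC (D k') (D k)) ler_norml; lra.
have := @le_supdist _ _ (dist (D k)) (dist (D k')) (D k').
by rewrite distxx subr0 ger0_norm ?dist_ge0//; apply; exact: dist_le1.
Qed.

Lemma hat_dense m e : 0 < e -> exists k, cdist m (hat k) <= e.
Proof.
move=> e0; have [k mk] := (svalP m).2 _ e0; exists k.
by apply: supdist_le => //; exact: ltW.
Qed.

Let completion_near1 m e : 0 < e ->
  nbhs (1%g : G) [set g | cdist (completion_act g m) m <= e].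
Proof.
move=> e0; have e3 : 0 < e / 3 by lra.
have [k mk] := (svalP m).2 _ e3.
apply: filterS (nbhs1_inv (gact_near1 (D k) e3)) => g /= gk.
apply: supdist_le; first exact: ltW.
move=> y /=; have := mk y; have := mk (gact g^-1%g y).
have := dist_triangle (D k) (gact g^-1%g (D k)) (gact g^-1%g y).
have := dist_triangle (gact g^-1%g (D k)) (D k) (gact g^-1%g y).
rewrite dist_gact (distC (D k) (gact g^-1%g (D k))) !ler_norml; lra.
Qed.

Program Definition completion : gspace R G :=
  @GSpace R G completion_point cdist completion_act _ _ _ _ _ _ _ _ completion_near1.
Next Obligation. by move=> m n; exact: supdist_ge0. Qed.
Next Obligation. by move=> m n; exact: supdist_le1. Qed.
Next Obligation. by move=> m; exact: supdistxx. Qed.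
Next Obligation. by move=> m n; exact: supdistC. Qed.
Next Obligation.
by move=> n m p; apply: supdist_triangle; [exact: (svalP m).1|exact: (svalP n).1|exact: (svalP p).1].
Qed.
Next Obligation.
move=> g m n; congr cinf; apply/seteqP; split=> e /= mne y; last exact: mne.
by have := mne (gact g y); rewrite gactK.
Qed.
Next Obligation. by move=> m; apply: completion_ext => y /=; rewrite invg1 gact1. Qed.
Next Obligation.
by move=> g h m; apply: completion_ext => y /=; rewrite invgM gactM.
Qed.

Lemma completion_separated (m n : completion) : dist m n = 0 -> m = n.
Proof.
move=> mn; suff mn' : sval m = sval n by apply: completion_ext => y; rewrite mn'.
apply: supdist_eq0.
- exact: (svalP m).1.
- exact: (svalP n).1.
- by rewrite -[leRHS]mn.
Qed.

Lemma completion_complete (F : set_system completion) : ProperFilter F ->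
  (forall e, 0 < e -> exists m : completion, F [set n : completion | dist m n <= e]) ->
  exists m : completion, forall e, 0 < e -> F [set n : completion | dist m n <= e].
Proof.
(* The pointwise upper limit along [F]; for a Cauchy filter the convergence is uniform. *)
move=> FF Fc; pose lim y := cinf [set r | F [set n : completion | sval n y <= r]].
have distE (m n : completion) y e : dist m n <= e -> `|sval m y - sval n y| <= e.
  apply: le_trans; apply: le_supdist; apply: unit_valued_dist.
    exact: (svalP m).1.
  exact: (svalP n).1.
have limE (m : completion) e : 0 < e -> F [set n : completion | dist m n <= e] -> forall y, `|lim y - sval m y| <= e.
  move=> e0 Fm y; have /andP[m0 m1] := (svalP m).1 y.
  have : lim y <= sval m y + e.
    apply: cinf_le; last by lra.
    by apply: filterS Fm => n /distE-/(_ y) /=; rewrite ler_norml; lra.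
  have : sval m y <= lim y + e.
    apply: le_cinfB; first by lra.
    move=> r Fr _; have [n [/= nr /distE-/(_ y)]] := filter_ex (filterI Fr Fm).
    by rewrite ler_norml; lra.
  by rewrite ler_norml; lra.
have limP : adherent lim.
  split=> [y|e e0]; first by rewrite cinf_ge0 cinf_le1.
  have e2 : 0 < e / 2 by lra.
  have [m /(limE _ _ e2) lm] := Fc _ e2.
  have [k mk] := (svalP m).2 _ e2; exists k => y.
  by have := lm y; have := mk y; rewrite !ler_norml; lra.
exists (exist _ lim limP) => e e0; have e2 : 0 < e / 2 by lra.
have [m Fm] := Fc _ e2; have lm := limE _ _ e2 Fm.
apply: filterS Fm => n /distE mn; apply: supdist_le; first exact: ltW.
by move=> y /=; have := lm y; have := mn y; rewrite !ler_norml; lra.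
Qed.

Section ExtendIsometry.
Variable f : selfisometry Y.
Hypotheses (Df : forall k, exists k', D k' = f (D k))
  (Db : forall k, exists k', D k' = bwd f (D k)).

Let b_approx k e : 0 < e -> exists k', forall y,
  `|dist (D k) (bwd f y) - dist (D k') y| <= e.
Proof.
move=> e0; have [k' k'E] := Df k; exists k' => y.
by rewrite -(fwd_iso f (D k)) (dist0r _ (bwdK f y)) k'E subrr normr0 ltW.
Qed.

Let f_approx k e : 0 < e -> exists k', forall y,
  `|dist (D k) (f y) - dist (D k') y| <= e.
Proof.
move=> e0; have [k' k'E] := Db k; exists k' => y.
by rewrite k'E -(fwd_iso f (bwd f (D k))) (dist0l _ (bwdK f _)) subrr normr0 ltW.
Qed.

Let cf (m : completion) : completion := exist _ _ (adherent_comp m b_approx).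
Let cb (m : completion) : completion := exist _ _ (adherent_comp m f_approx).

Let cfK (m : completion) : cb (cf m) = m.
Proof. by apply: completion_ext => y /=; apply: adherent0; exact: fwdK. Qed.

Let cbK (m : completion) : cf (cb m) = m.
Proof. by apply: completion_ext => y /=; apply: adherent0; exact: bwdK. Qed.

Let cf_iso (m n : completion) : dist (cf m) (cf n) = dist m n.
Proof.
congr cinf; apply/seteqP; split=> e /= mne y; last exact: mne.
by have := mne (f y); rewrite !(adherent0 _ (fwdK f y)).
Qed.

(** The isometry acts on functions by composition with its inverse, which preserves adherence
    because [D] is closed under both maps. Adherent functions agree at points at distance zero, so
    the inverses become exact. *)
Lemma extend_isometry : exists f' : selfisometry completion,
  forall k, exists k', f' (hat k) = hat k' /\ D k' = f (D k).
Proof.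
have iso0 (m n : completion) : m = n -> dist m n = 0 by move=> ->; exact: distxx.
exists (@SelfIsometry _ _ completion cf cb cf_iso (fun m => iso0 _ _ (cfK m)) (fun m => iso0 _ _ (cbK m))).
move=> k; have [k' k'E] := Df k; exists k'; split=> //.
apply: completion_ext => y /=.
by rewrite k'E -(fwd_iso f (D k)) (dist0r _ (bwdK f y)).
Qed.

End ExtendIsometry.

Lemma completion_realization (l : seq (completion * completion)) e
    (F : seq completion) r : 0 < r -> almost_iso (@dist _ _ completion) l e ->
  exists f : selfisometry completion, forall x y : completion, List.In x F -> List.In y F ->
    `|dist (f x) y - paircost (@dist _ _ completion) l e x y| <= r.
Proof.
(* Every point is replaced by one of [D] within [s]. Two distances at [2 * s] each and the change of
   [e] by at most [3 * s] alter the cost by [7 * s]; returning to the original points costs another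
   [2 * s]. *)
move=> r0 [e0 le]; pose s := r / 9; have s0 : 0 < s by rewrite /s; lra.
have /choice[a aP] : forall m : completion, exists k, dist m (hat k) <= s.
  by move=> m; exact: hat_dense.
(* The increase by [2 * s] absorbs the additional distortion of the approximated list, which is at
   most [4 * s]. *)
have [q /andP[q1 q2]] : exists q : rat, e + 2 * s <= ratr q <= e + 3 * s.
  have : e + 2 * s < e + 3 * s by lra.
  by move=> /rat_in_itvoo[q]; rewrite in_itv/= => /andP[/ltW q1 /ltW q2]; exists q; rewrite q1.
pose h (m : completion) : completion := hat (a m).
have hD m n : dist (h m) (h n) = dist (D (a m)) (D (a n)) by exact: hat_dist.
have near (m n : completion) : dist m n <= dist (D (a m)) (D (a n)) + 2 * s /\
    dist (D (a m)) (D (a n)) <= dist m n + 2 * s.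
  rewrite -hD; have hm : dist m (h m) <= s := aP m; have hn : dist n (h n) <= s := aP n.
  have := dist_triangle (h m) m n; have := dist_triangle (h n) (h m) n.
  have := dist_triangle m (h m) (h n); have := dist_triangle n m (h n).
  by rewrite (distC (h n) n) (distC (h m) m); lra.
pose la := List.map (fun p : completion * completion => (a p.1, a p.2)) l.
have lapP p : List.In p l -> List.In (D (a p.1), D (a p.2)) (List.map (fun p => (D p.1, D p.2)) la).
  move=> lp; apply/List.in_map_iff; exists (a p.1, a p.2); split=> //.
  by apply/List.in_map_iff; exists p.
have lapV p : List.In p (List.map (fun p => (D p.1, D p.2)) la) ->
    exists2 q, List.In q l & p = (D (a q.1), D (a q.2)).
  by move=> /List.in_map_iff[_ [<-]] /List.in_map_iff[u [<-]] lu; exists u.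
have [|f [fP fD bD]] := D_realization (l := la) (q := q) (List.map a F).
  split=> [|p p' /lapV[u lu ->] /lapV[u' lu' ->]] /=; first by lra.
  have := le _ _ lu lu'; have [] := near u.1 u'.1; have [] := near u.2 u'.2.
  by rewrite !ler_norml; lra.
have [f' f'P] := extend_isometry fD bD; exists f' => x y xF yF.
have [k [f'k kE]] := f'P (a x).
have := fP _ _ (List.in_map a _ _ xF) (List.in_map a _ _ yF).
set P := paircost _ _ _ _ _ => fE; set P' := paircost _ _ _ _ _.
have PP' : P <= P' + 7 * s.
  apply: paircost_leB => [|p lp]; first by lra.
  exists (D (a p.1), D (a p.2)) => //=; first exact: lapP.
  have [] := near x p.1; have [] := near p.2 y.
  by have := dist_ge0 (D (a x)) (D (a p.1)); have := dist_ge0 (D (a p.2)) (D (a y)); lra.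
have P'P : P' <= P + 7 * s.
  apply: paircost_leB => [|_ /lapV[p lp ->]]; first by lra.
  exists p => //=; have [] := near x p.1; have [] := near p.2 y.
  by have := dist_ge0 x p.1; have := dist_ge0 p.2 y; lra.
pose hk : completion := hat k.
have hkE : dist hk (h y) = P by rewrite -fE -kE; exact: hat_dist.
have fxhk : dist (f' x) hk <= s by rewrite /hk -f'k fwd_iso; exact: aP.
have hy : dist y (h y) <= s := aP y.
have := dist_triangle hk (f' x) y; have := dist_triangle (h y) hk y.
have := dist_triangle (f' x) hk (h y); have := dist_triangle y (f' x) (h y).
rewrite (distC (h y) y) (distC hk (f' x)) hkE ler_norml.
have s9 : 9 * s = r by rewrite /s; lra.
lra.
Qed.

End Completion.

(** * The isometry group *)

Record isometry (R : realType) (G : topologicalGroupType) (M : gspace R G) := Isometry {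
  imap :> M -> M;
  iinv : M -> M;
  imap_iso : forall x y, dist (imap x) (imap y) = dist x y;
  imapK : cancel imap iinv;
  iinvK : cancel iinv imap
}.

HB.instance Definition _ R G (M : gspace R G) := gen_eqMixin (isometry M).
HB.instance Definition _ R G (M : gspace R G) := gen_choiceMixin (isometry M).

Section IsometryGroup.
Variables (R : realType) (G : topologicalGroupType) (M : gspace R G).
Implicit Types (f g h : isometry M) (x y : M).

Lemma isometry_ext f g : f =1 g -> f = g.
Proof.
case: f g => [f f' fi fK f'K] [g g' gi gK g'K] /= fg.
have {}fg : f = g by apply/funext. subst g.
have f'g' : f' = g' by apply/funext => x; rewrite -{1}(g'K x) fK.
by subst g'; congr Isometry; exact: Prop_irrelevance.
Qed.

Lemma iinv_iso f x y : dist (iinv f x) (iinv f y) = dist x y.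
Proof. by rewrite -(imap_iso f) !iinvK. Qed.

Definition isometry1 : isometry M :=
  @Isometry _ _ M id id (fun _ _ => erefl) (fun _ => erefl) (fun _ => erefl).

Definition isometryV f : isometry M :=
  @Isometry _ _ M (iinv f) f (iinv_iso f) (@iinvK _ _ _ f) (@imapK _ _ _ f).

Program Definition isometryM f g : isometry M :=
  @Isometry _ _ M (f \o g) (iinv g \o iinv f) _ _ _.
Next Obligation. by move=> f g x y /=; rewrite !imap_iso. Qed.
Next Obligation. by move=> f g x /=; rewrite !imapK. Qed.
Next Obligation. by move=> f g x /=; rewrite !iinvK. Qed.

Fact isometry_mulA : associative isometryM.
Proof. by move=> f g h; exact: isometry_ext. Qed.
Fact isometry_mul1 : left_id isometry1 isometryM.
Proof. by move=> f; exact: isometry_ext. Qed.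
Fact isometry_mulr1 : right_id isometry1 isometryM.
Proof. by move=> f; exact: isometry_ext. Qed.
Fact isometry_mulV : left_inverse isometry1 isometryV isometryM.
Proof. by move=> f; apply: isometry_ext => x /=; rewrite imapK. Qed.
Fact isometry_mulrV : right_inverse isometry1 isometryV isometryM.
Proof. by move=> f; apply: isometry_ext => x /=; rewrite iinvK. Qed.

HB.instance Definition _ := isGroup.Build (isometry M)
  isometry_mulA isometry_mul1 isometry_mulr1 isometry_mulV isometry_mulrV.

Lemma isometry1E x : (1%g : isometry M) x = x. Proof. by []. Qed.
Lemma isometryME f g x : (f * g)%g x = f (g x). Proof. by []. Qed.

Definition near_on (s : seq M) (e : R) f g := forall x, List.In x s -> dist (f x) (g x) <= e.

Definition isometry_nbhs f : set_system (isometry M) :=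
  [set U | exists s e, 0 < e /\ forall g, near_on s e f g -> U g].

HB.instance Definition _ := hasNbhs.Build (isometry M) isometry_nbhs.

Fact isometry_nbhs_filter f : ProperFilter (nbhs f).
Proof.
apply: Build_ProperFilter_ex.
  move=> U [s [e [e0 sU]]]; exists f; apply: sU => x _.
  by rewrite distxx ltW.
split.
- by exists [::], 1; split.
- move=> U V [s [e [e0 sU]]] [t [r [r0 tV]]].
  exists (s ++ t), (Num.min e r); split; first by rewrite lt_min e0.
  move=> g fg; split.
    apply: sU => x xs; apply: (le_trans (fg x _)); last by rewrite ge_min lexx.
    by apply/List.in_app_iff; left.
  apply: tV => x xt; apply: (le_trans (fg x _)); last by rewrite ge_min lexx orbT.
  by apply/List.in_app_iff; right.
- by move=> U V UV [s [e [e0 sU]]]; exists s, e; split=> // g /sU/UV.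
Qed.

Fact isometry_nbhs_singleton f (U : set (isometry M)) : nbhs f U -> U f.
Proof.
by move=> [s [e [e0 sU]]]; apply: sU => x _; rewrite distxx ltW.
Qed.

Fact isometry_nbhs_nbhs f (U : set (isometry M)) : nbhs f U -> nbhs f (nbhs^~ U).
Proof.
move=> [s [e [e0 sU]]]; exists s, (e / 2); split; first by lra.
move=> g fg; exists s, (e / 2); split; first by lra.
move=> h gh; apply: sU => x xs; have := dist_triangle (g x) (f x) (h x).
by have := fg _ xs; have := gh _ xs; lra.
Qed.

HB.instance Definition _ := Nbhs_isNbhsTopological.Build (isometry M)
  isometry_nbhs_filter isometry_nbhs_singleton isometry_nbhs_nbhs.

Fact isometry_group_topology :
  @group_topology (isometry M) (Topological.class (isometry M)).
Proof.
split.
  move=> [f g] U [s [e [e0 sU]]] /=.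
  exists ([set h : isometry M | near_on (List.map g s) (e / 2) f h], [set h : isometry M | near_on s (e / 2) g h]).
    by split; [exists (List.map g s), (e / 2)|exists s, (e / 2)]; split=> //; lra.
  move=> [h k] /= [fh gk]; apply: sU => x xs; rewrite !isometryME.
  have := dist_triangle (h (g x)) (f (g x)) (h (k x)); rewrite imap_iso.
  by have := fh _ (List.in_map g _ _ xs); have := gk _ xs; lra.
move=> f U [s [e [e0 sU]]] /=.
exists (List.map (iinv f) s), e; split=> // g fg; apply: sU => x xs.
have := fg _ (List.in_map _ _ _ xs); rewrite iinvK => xg.
by rewrite -(imap_iso g) iinvK distC.
Qed.

HB.instance Definition _ :=
  GroupTopological_isTopologicalGroup.Build (isometry M) isometry_group_topology.

Lemma near_on_nbhs s e f : 0 < e -> nbhs f [set g | near_on s e f g].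
Proof. by move=> e0; exists s, e. Qed.

Lemma isometry_mulKV f x : f ((f^-1)%g x) = x. Proof. exact: iinvK. Qed.

Lemma distV f x y : dist ((f^-1)%g x) y = dist x (f y).
Proof. by rewrite -(imap_iso f) isometry_mulKV. Qed.

Definition separated := forall x y, dist x y = 0 -> x = y.

Definition complete_dist := forall F : set_system M, ProperFilter F ->
  (forall e, 0 < e -> exists x, F [set y | dist x y <= e]) ->
  exists x, forall e, 0 < e -> F [set y | dist x y <= e].

Hypothesis sepM : separated.

Lemma dist_small x y : (forall e, 0 < e -> dist x y <= e) -> x = y.
Proof.
move=> xy; apply: sepM; apply/eqP; rewrite eq_le dist_ge0 andbT.
by apply/ler_addgt0Pr => e e0; rewrite add0r; exact: xy.
Qed.

Lemma isometry_hausdorff : hausdorff_space (isometry M).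
Proof.
move=> f g fg; apply: isometry_ext => x; apply: dist_small => e e0.
have e2 : 0 < e / 2 by lra.
have [h [/= fh gh]] := fg _ _ (near_on_nbhs [:: x] f e2) (near_on_nbhs [:: x] g e2).
have := fh x (or_introl erefl); have := gh x (or_introl erefl).
by have := dist_triangle (h x) (f x) (g x); rewrite (distC (h x)); lra.
Qed.

Lemma sup_entourage (T : choiceType) (I : Type) (Tc : I -> Uniform T) i E :
  @entourage (Uniform.Pack (Tc i)) E -> @entourage (sup_topology Tc) E.
Proof.
move=> entE; pose pe : {classic I} * set (T * T) := (i, E).
have entPE : `[< @entourage (Uniform.Pack (Tc pe.1)) pe.2 >] by apply/asboolP.
exists E => //=; exists (fset1 (exist _ pe entPE)).
  by move=> ? _; rewrite in_setE.
by rewrite set_fset1 bigcap_set1.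
Qed.

Hypothesis complM : complete_dist.

Lemma pointwise_limit (F : set_system (isometry M)) : ProperFilter F ->
  (forall x e, 0 < e -> exists y, F [set h : isometry M | dist y (h x) <= e]) ->
  exists l : M -> M, forall x e, 0 < e -> F [set h : isometry M | dist (l x) (h x) <= e].
Proof.
move=> FF Fc; suff : forall x, exists y, forall e, 0 < e -> F [set h : isometry M | dist y (h x) <= e].
  by move=> /choice[l lP]; exists l.
move=> x; have [|y yP] := @complM ((fun h : isometry M => h x) @ F) _.
  by move=> e e0; have [y Fy] := Fc x e e0; exists y.
by exists y.
Qed.

(** Without control of the inverses the limit would be an isometric embedding, possibly not
    surjective; the limit of the inverses supplies the inverse. *)
Lemma isometry_limit (F : set_system (isometry M)) : ProperFilter F ->
  (forall x e, 0 < e -> exists y, F [set h : isometry M | dist y (h x) <= e]) ->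
  (forall x e, 0 < e -> exists y, F [set h : isometry M | dist y ((h^-1)%g x) <= e]) ->
  exists l : isometry M, forall x e, 0 < e -> F [set h : isometry M | dist (l x) (h x) <= e].
Proof.
move=> FF Fc FVc; have [l lP] := pointwise_limit FF Fc.
have /choice[k kP] : forall x, exists y, forall e, 0 < e ->
    F [set h : isometry M | dist y ((h^-1)%g x) <= e].
  move=> x; have [|y yP] := @complM ((fun h : isometry M => (h^-1)%g x) @ F) _.
    by move=> e e0; have [y Fy] := FVc x e e0; exists y.
  by exists y.
have liso x y : dist (l x) (l y) = dist x y.
  apply/eqP; rewrite eq_le; apply/andP; split; apply/ler_addgt0Pr => e e0;
    have e2 : 0 < e / 2 by [lra|lra].
    have [h [/= lx ly]] := filter_ex (filterI (lP x _ e2) (lP y _ e2)).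
    have := dist_triangle (h x) (l x) (l y); have := dist_triangle (h y) (h x) (l y).
    by rewrite imap_iso (distC (h y)); lra.
  have [h [/= lx ly]] := filter_ex (filterI (lP x _ e2) (lP y _ e2)).
  have := dist_triangle (l x) (h x) (h y); have := dist_triangle (l y) (l x) (h y).
  by rewrite imap_iso (distC (h x)); lra.
have lkK : cancel l k.
  move=> x; apply: dist_small => e e0; have e2 : 0 < e / 2 by lra.
  have [h [/= lx klx]] := filter_ex (filterI (lP x _ e2) (kP (l x) _ e2)).
  by have := dist_triangle ((h^-1)%g (l x)) (k (l x)) x; rewrite distV; lra.
have klK : cancel k l.
  move=> x; apply: dist_small => e e0; have e2 : 0 < e / 2 by lra.
  have [h [/= lx klx]] := filter_ex (filterI (lP (k x) _ e2) (kP x _ e2)).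
  move: klx; rewrite distC distV => klx.
  by have := dist_triangle (h (k x)) (l (k x)) x; rewrite (distC (h (k x)) x); lra.
by exists (@Isometry _ _ M l k liso lkK klK).
Qed.

Lemma near_on_filter (F : set_system (isometry M)) (l : isometry M) s e : Filter F ->
  (forall x e, 0 < e -> F [set h : isometry M | dist (l x) (h x) <= e]) ->
  0 < e -> F [set h : isometry M | near_on s e l h].
Proof.
move=> FF Fl e0; elim: s => [|x s IHs]; first by apply: filterS filterT => h _ x [].
by apply: filterS2 (Fl x e e0) IHs => h hx hs y [<-//|]; exact: hs.
Qed.

(** The left uniformity makes the images [h x] Cauchy, the right one the preimages; the upper
    uniformity provides both. *)
Lemma isometry_complete : complete_group (isometry M).
Proof.
move=> F FF Fc.
have FL x e : 0 < e -> exists y, F [set h : isometry M | dist y (h x) <= e].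
  move=> e0; pose E : set (isometry M * isometry M) :=
    [set gh | near_on [:: x] e 1%g (gh.1^-1 * gh.2)%g].
  have : @entourage (upper_uniform (isometry M)) E.
    apply: (@sup_entourage _ _ _ true).
    by exists [set h : isometry M | near_on [:: x] e 1%g h] => //; exact: near_on_nbhs.
  move=> /Fc[[P Q] /= [FP FQ] PQ]; have [g Pg] := filter_ex FP.
  exists (g x); apply: filterS FQ => h Qh.
  have /(_ x (or_introl erefl)) := PQ (g, h) (conj Pg Qh).
  by rewrite isometry1E distC isometryME distV distC.
have FR x e : 0 < e -> exists y, F [set h : isometry M | dist y ((h^-1)%g x) <= e].
  move=> e0; pose E : set (isometry M * isometry M) :=
    [set gh | near_on [:: x] e 1%g (gh.2 * gh.1^-1)%g].
  have : @entourage (upper_uniform (isometry M)) E.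
    apply: (@sup_entourage _ _ _ false).
    by exists [set h : isometry M | near_on [:: x] e 1%g h] => //; exact: near_on_nbhs.
  move=> /Fc[[P Q] /= [FP FQ] PQ]; have [g Pg] := filter_ex FP.
  exists ((g^-1)%g x); apply: filterS FQ => h Qh.
  have /(_ x (or_introl erefl)) := PQ (g, h) (conj Pg Qh).
  by move=> xhg; rewrite /= distC distV; exact: xhg.
have [l lP] := isometry_limit FF FL FR; exists l.
apply/cvg_sup => -[] A; rewrite /= => /nbhsP[E [U [s [e [e0 sU]]] UE] EA].
  apply: filterS (near_on_filter s FF lP e0) => h lh.
  apply: EA; apply/xsectionP; apply: UE; apply: sU => x xs /=.
  change (dist x ((l^-1)%g (h x)) <= e).
  by rewrite distC distV distC; exact: lh.
apply: filterS (near_on_filter (List.map (l^-1)%g s) FF lP e0) => h lh.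
apply: EA; apply/xsectionP; apply: UE; apply: sU => x xs /=.
have := lh _ (List.in_map _ _ _ xs); rewrite isometry_mulKV.
by [].
Qed.

End IsometryGroup.

(** * Free amalgamation and products that spread points *)

Section FreeAmalgamation.
Variables (R : realType) (G : topologicalGroupType) (M : gspace R G).
Local Notation H := (isometry M).

Definition realizable := forall (l : seq (M * M)) e (F : seq M) r,
  0 < r -> almost_iso (@dist _ _ M) l e ->
  exists f : H, forall x y : M, List.In x F -> List.In y F ->
    `|dist (f x) y - paircost (@dist _ _ M) l e x y| <= r.

Hypothesis realM : realizable.

(** The cost function of [l] is at most [e] at each pair of [l], and it is realized up to [r]. *)
Lemma almost_homogeneous (l : seq (M * M)) e r : 0 < r -> almost_iso (@dist _ _ M) l e ->
  exists h : H, forall p, List.In p l -> dist (h p.1) p.2 <= e + r.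
Proof.
move=> r0 le; have [h hP] := realM (List.map fst l ++ List.map snd l) r0 le.
exists h => p lp; have /hP : List.In p.1 (List.map fst l ++ List.map snd l).
  by apply/List.in_app_iff; left; exact: List.in_map.
move=> /(_ p.2) hp; have {hp} : `|dist (h p.1) p.2 - paircost (@dist _ _ M) l e p.1 p.2| <= r.
  by apply: hp; apply/List.in_app_iff; right; exact: List.in_map.
have := paircost_le p.1 p.2 le.1 lp; rewrite !distxx add0r addr0.
by rewrite ler_norml; lra.
Qed.

(** Realize the cost function of the identity on [a]. The isometry almost fixes [a] and moves [q] as
    far from [p] as the triangle inequalities through [a] and the bound 1 allow. *)
Lemma free_amalgam (a p q : seq M) r : 0 < r ->
  exists h : H, (forall x, List.In x a -> dist (h x) x <= r) /\
    forall x y t, List.In x p -> List.In y q -> t <= 1 ->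
      (forall z, List.In z a -> t <= dist x z + dist z y) -> t - r <= dist x (h y).
Proof.
move=> r0; have aa : almost_iso (@dist _ _ M) (List.map (fun x => (x, x)) a) 0.
  split=> // u v /List.in_map_iff[x [<- _]] /List.in_map_iff[y [<- _]] /=.
  by rewrite subrr normr0 mulr0.
have [h hP] := realM (a ++ p ++ q) r0 aa.
exists h; split.
  move=> x xa; have xF : List.In x (a ++ p ++ q) by apply/List.in_app_iff; left.
  have := hP x x xF xF; have := paircost_le x x aa.1 (List.in_map (fun x => (x, x)) _ _ xa).
  by rewrite /= distxx !addr0 ler_norml; lra.
move=> x y t xp yq t1 tz.
have xF : List.In x (a ++ p ++ q).
  by apply/List.in_app_iff; right; apply/List.in_app_iff; left.
have yF : List.In y (a ++ p ++ q).
  by apply/List.in_app_iff; right; apply/List.in_app_iff; right.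
have := hP y x yF xF; rewrite (distC (h y) x) ler_norml => /andP[+ _].
suff : t <= paircost (@dist _ _ M) (List.map (fun x => (x, x)) a) 0 y x by lra.
apply: le_cinf => // _ [u /List.in_map_iff[z [<- za]] ->] _ /=.
by have := tz z za; rewrite (distC x) (distC z y); lra.
Qed.

(* A common setting for a normal subgroup [N] (the family [{N}]) and for the
   neighbourhoods of the identity in a coarser group topology. *)
Section Spreading.
Variable big : set H -> Prop.
Hypothesis big_cap : forall V W, big V -> big W -> exists2 U, big U & U `<=` V `&` W.
Hypothesis big_mul : forall V, big V -> exists2 W, big W &
  forall f g, W f -> W g -> V (f * g)%g.
Hypothesis big_inv : forall V, big V -> exists2 W, big W & forall f, W f -> V (f^-1)%g.
Hypothesis big_conj : forall V (h : H), big V -> exists2 W, big W &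
  forall f, W f -> V (h * f * h^-1)%g.
Hypothesis big_local : forall V, big V -> exists W (s : seq M) (e : R), [/\ big W, 0 < e &
  forall f h : H, W f -> (forall x, List.In x s -> dist (h x) x <= e) -> V (h * f * h^-1)%g].

Variables (x0 : M) (e0 : R).
Hypothesis e0_gt0 : 0 < e0.
Hypothesis big_far0 : forall V A, big V ->
  exists2 g : H, V g & forall z, List.In z A -> e0 <= dist (g x0) z.

Let e1 : R := Num.min (e0 / 2) 1.
Let e1_gt0 : 0 < e1. Proof. by rewrite /e1 lt_min; apply/andP; split=> //; have := e0_gt0; lra. Qed.
Let e1_le : e1 <= e0 / 2. Proof. by rewrite /e1 ge_min lexx. Qed.
Let e1_le1 : e1 <= 1. Proof. by rewrite /e1 ge_min lexx orbT. Qed.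

(** Conjugate by an [h] that takes [x0] to within [e0 / 4] of [x]; this loses at most [e0 / 4]. *)
Lemma big_far x V A : big V ->
  exists2 g : H, V g & forall z, List.In z A -> e1 <= dist (g x) z.
Proof.
move=> bV; have e4 : 0 < e0 / 4 by have := e0_gt0; lra.
have [|h /(_ (x0, x) (or_introl erefl)) /= hx] := @almost_homogeneous [:: (x0, x)] 0 _ e4.
  by split=> // p q [<-|//] [<-|//] /=; rewrite !distxx subrr normr0 mulr0.
have [W bW WV] := big_conj h bV.
have [f Wf fA] := big_far0 (List.map (h^-1)%g A) bW.
exists (h * f * h^-1)%g; first exact: WV.
move=> z zA; have := fA _ (List.in_map _ _ _ zA).
change ((h * f * h^-1)%g x) with (h (f ((h^-1)%g x))).
rewrite (distC _ ((h^-1)%g z)) distV distC => fz.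
have := dist_triangle (h (f ((h^-1)%g x))) (h (f x0)) z.
rewrite !imap_iso (distC x0) distV; rewrite distC in hx.
by have := e1_le; lra.
Qed.

(** Take [n1] times the conjugate of [n2] by a generic [h] almost fixing [a]. Then the images of [a]
    under [n2] are amalgamated freely over [a] with the preimages under [n1], so [dist z (n z')] is
    nearly the shortest path through some [u] in [a], capped at 1. *)
Lemma big_product V A r : big V -> 0 < r -> exists W (a : seq M),
  [/\ big W, forall x, List.In x A -> List.In x a &
  forall n1 n2 : H, W n1 -> W n2 -> exists2 n : H, V n &
    forall (z z' : M) (t : R), List.In z a -> List.In z' a -> t <= 1 ->
      (forall u, List.In u a -> t <= dist z (n1 u) + dist u (n2 z')) ->
      t - r <= dist z (n z')].
Proof.
move=> bV r0; have [W1 bW1 W1V] := big_mul bV.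
have [W2 [s [e [bW2 e_gt0 W2W1]]]] := big_local bW1.
have [W bW WW12] := big_cap bW1 bW2.
(* The bound [e] keeps the conjugate inside [W1]; [r / 2] is spent on the amalgam and again on
   replacing [h z'] by [z']. *)
pose r' := Num.min e (r / 2).
have r'0 : 0 < r' by rewrite lt_min e_gt0; lra.
have r'e : r' <= e by rewrite ge_min lexx.
have r'r : r' <= r / 2 by rewrite ge_min lexx orbT.
exists W, (s ++ A); split=> //.
  by move=> x xA; apply/List.in_app_iff; right.
move=> n1 n2 Wn1 Wn2.
have [h [ha hP]] := free_amalgam (s ++ A) (List.map (n1^-1)%g (s ++ A)) (List.map n2 (s ++ A)) r'0.
exists (n1 * (h * n2 * h^-1))%g.
  apply: W1V; first exact: (WW12 _ Wn1).1.
  apply: W2W1; first exact: (WW12 _ Wn2).2.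
  by move=> x xs; apply: le_trans r'e; apply: ha; apply/List.in_app_iff; left.
move=> z z' t za z'a t1 tu.
have := hP _ _ t (List.in_map _ _ _ za) (List.in_map _ _ _ z'a) t1.
have tu' u : List.In u (s ++ A) -> t <= dist ((n1^-1)%g z) u + dist u (n2 z').
  by move=> /tu; rewrite distV.
move=> /(_ tu'); rewrite distV.
change ((n1 * (h * n2 * h^-1))%g z') with (n1 (h (n2 ((h^-1)%g z')))).
have := ha _ z'a; have := dist_triangle (n1 (h (n2 ((h^-1)%g z')))) z (n1 (h (n2 z'))).
by rewrite !imap_iso distV (distC z' (h z')); lra.
Qed.

(** Combine the inverse of [g] with [g], where [g] moves [x] far from [a]. A path through [u] then
    has the length of a path from [g z] to [g z'], so no distance in [A] shrinks by more than [r],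
    while its second half is long if it ends at [g x]. *)
Let big_spread1 x V A r : big V -> 0 < r -> exists2 n : H, V n &
  (forall z z', List.In z A -> List.In z' A -> dist z z' - r <= dist z (n z')) /\
  (forall z, List.In z A -> e1 - r <= dist z (n x)).
Proof.
move=> bV r0; have [W [a [bW Aa Wn]]] := big_product (x :: A) bV r0.
have [W1 bW1 W1W] := big_inv bW; have [W2 bW2 W2W] := big_cap bW bW1.
have [g W2g ga] := big_far x a bW2.
have [n Vn nP] := Wn (g^-1)%g g (W1W _ (W2W _ W2g).2) (W2W _ W2g).1.
exists n => //; split=> [z z' zA z'A|z zA]; apply: nP => //.
- by apply: Aa; right.
- by apply: Aa; right.
- exact: dist_le1.
- move=> u ua; rewrite (distC z ((g^-1)%g u)) distV (distC u (g z)) -(imap_iso g z z').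
  exact: dist_triangle.
- by apply: Aa; right.
- by apply: Aa; left.
- move=> u /ga; rewrite (distC u); have := dist_ge0 z ((g^-1)%g u).
  by lra.
Qed.

(** Points of [X] are treated one at a time: a further product spoils what was achieved only by the
    error terms. *)
Let big_spread X V A r : big V -> 0 < r -> exists2 n : H, V n &
  (forall z z', List.In z A -> List.In z' A -> dist z z' - r <= dist z (n z')) /\
  (forall z x, List.In z A -> List.In x X -> e1 - r <= dist z (n x)).
Proof.
elim: X V A r => [|x X IHX] V A r bV r0.
  have [n Vn [nA _]] := big_spread1 x0 A bV r0.
  by exists n => //; split=> // z x _ [].
have r4 : 0 < r / 4 by lra.
have [W [a [bW Aa Wn]]] := big_product (A ++ x :: X) bV r4.
have [n1 Wn1 [n1a n1X]] := IHX W a _ bW r4.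
have [n2 Wn2 [n2a n2x]] := big_spread1 x a bW r4.
have [n Vn nP] := Wn n1 n2 Wn1 Wn2; exists n => //.
have Xa z : List.In z (x :: X) -> List.In z a.
  by move=> zX; apply: Aa; apply/List.in_app_iff; right.
have {}Aa z : List.In z A -> List.In z a.
  by move=> zA; apply: Aa; apply/List.in_app_iff; left.
split=> [z z' zA z'A|z y zA yX].
  suff : dist z z' - 2 * (r / 4) - r / 4 <= dist z (n z') by lra.
  apply: nP; [exact: Aa|exact: Aa| |].
    by have := dist_le1 z z'; lra.
  move=> u ua; have := n1a z u (Aa _ zA) ua; have := n2a u z' ua (Aa _ z'A).
  by have := dist_triangle u z z'; lra.
suff : e1 - 2 * (r / 4) - r / 4 <= dist z (n y) by lra.
apply: nP; [exact: Aa|exact: Xa| |].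
  by have := e1_le1; lra.
move=> u ua; case: yX => [<-|yX].
  by have := n2x u ua; have := dist_ge0 z (n1 u); lra.
have := n1X z y (Aa _ zA) yX; have := n2a u y ua (Xa _ (or_intror yX)).
by have := dist_triangle (n1 u) z (n1 y); rewrite imap_iso; lra.
Qed.

Let spread rho := forall V A, big V -> exists2 n : H, V n &
  forall z z', List.In z A -> List.In z' A -> rho <= dist z (n z').

Let spreadW rho rho' : rho <= rho' -> spread rho' -> spread rho.
Proof.
move=> rr sp V A bV; have [n Vn nA] := sp V A bV.
by exists n => // z z' zA z'A; apply: le_trans rr _; exact: nA.
Qed.

(** In the product of [n] with a generic conjugate of itself, both halves of every path have length
    at least [rho]. *)
Let spread_double rho r : 0 < r -> spread rho -> spread (Num.min 1 (2 * rho) - r).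
Proof.
move=> r0 sp V A bV; have [W [a [bW Aa Wn]]] := big_product A bV r0.
have [n Wn0 na] := sp W a bW; have [m Vm mP] := Wn n n Wn0 Wn0.
exists m => // z z' zA z'A; apply: mP; [exact: Aa|exact: Aa| |].
  by rewrite ge_min lexx.
move=> u ua; rewrite ge_min; apply/orP; right.
by have := na z u (Aa _ zA) ua; have := na u z' ua (Aa _ z'A); lra.
Qed.

Let spread0 : spread (e1 / 2).
Proof.
move=> V A bV; have e12 : 0 < e1 / 2 by have := e1_gt0; lra.
have [n Vn [_ nA]] := big_spread A A bV e12; exists n => // z z' zA z'A.
by have := nA z z' zA z'A; lra.
Qed.

Let spread1 r : 0 < r -> spread (1 - r).
Proof.
move=> r0; have [r1|r1] := leP 1 r.
  by apply: spreadW spread0; have := e1_gt0; lra.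
have e_gt0 := e1_gt0; pose d := e1 / 2.
have d0 : 0 < d by rewrite /d; lra.
(* As long as the bound is at least [d], doubling it gains at least [d], of which the error takes at
   most [d / 2]. Linear growth suffices to reach [1 - r]. *)
have sp k : spread (Num.min (1 - r) (d + k%:R * (d / 2))).
  elim: k => [|k IHk].
    by rewrite mul0r addr0; apply: spreadW spread0; rewrite ge_min lexx orbT.
  pose r' := Num.min r (Num.min (d / 2) (1 - r)).
  have r'0 : 0 < r' by rewrite !lt_min r0; apply/andP; split; lra.
  have r'r : r' <= r by rewrite ge_min lexx.
  have r'd : r' <= d / 2 by rewrite !ge_min lexx orbT.
  have r'1 : r' <= 1 - r by rewrite !ge_min lexx !orbT.
  apply: spreadW (spread_double r'0 IHk).
  have kd : 0 <= k%:R * (d / 2) by rewrite mulr_ge0// ltW//; lra.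
  rewrite -natr1 mulrDl mul1r; set c := k%:R * (d / 2) in kd *.
  have [r1c|r1c] := leP (1 - r) (d + c);
    (have [r1d|r1d] := leP (1 - r) (d + (c + d / 2)));
    (set m := 2 * _); have [m1|m1] := leP 1 m; rewrite /m in m1 *; lra.
have := archi_boundP (ltW (divr_gt0 (@ltr0n R 2) d0)).
set k := Num.bound _; rewrite ltr_pdivrMr// => kd.
by apply: spreadW (sp k); rewrite le_min lexx/=; lra.
Qed.

(** Let [n] spread [a] almost to distance 1 and let [k] be generic, with [k a] far from both [a] and
    [g a]. Then [n], [k] and [g^-1 * k] all place [a] in nearly the same way relative to [a], so
    conjugates [v] and [w] of [n] approximate the latter two on [a]. Hence [v^-1 * g * w] almost
    fixes [a]. *)
Lemma big_dense V (g : H) A e : big V -> 0 < e -> exists v w u : H,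
  [/\ V v, V w, forall x, List.In x A -> dist (u x) x <= e & g = (v * u * w^-1)%g].
Proof.
move=> bV e_gt0; have [W [s [d [bW d0 WV]]]] := big_local bV.
(* The conjugating isometries move [s] by at most [2 * r], and [u] inherits an error of [4 * r] from
   each of [v] and [w]. *)
pose a := s ++ A; pose r := Num.min (d / 2) (e / 8).
have r0 : 0 < r by rewrite lt_min; apply/andP; split; lra.
have rd : r <= d / 2 by rewrite ge_min lexx.
have re : r <= e / 8 by rewrite ge_min lexx orbT.
have [n Wn na] := spread1 r0 a bW.
(* Over the empty set no path is available, so all distances become almost 1. *)
have [k [_ kP]] := free_amalgam [::] (a ++ List.map g a) a r0.
have kf x y : List.In x a -> List.In y a -> 1 - r <= dist x (k y).
  by move=> xa ya; apply: kP => //; apply/List.in_app_iff; left.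
have kg x y : List.In x a -> List.In y a -> 1 - r <= dist (g x) (k y).
  by move=> xa ya; apply: kP => //; apply/List.in_app_iff; right; exact: List.in_map.
have conj (c : H) : (forall x y, List.In x a -> List.In y a -> 1 - r <= dist x (c y)) ->
    exists2 v, V v & forall x, List.In x a -> dist (v x) (c x) <= 4 * r.
  move=> cf.
  (* The conjugating isometry has to almost fix [a] and take [n x] close to [c x]. All mixed
     distances lie between [1 - r] and 1, so the distortion is at most [r]. *)
  pose l := List.map (fun x => (x, x)) a ++ List.map (fun x => (n x, c x)) a.
  have r2 : 0 < r / 2 by lra.
  have [|h hP] := @almost_homogeneous l (r / 2) r r0.
    split=> [|p q]; first by lra.
    move=> /List.in_app_iff[] /List.in_map_iff[x [<- xa]];
    move=> /List.in_app_iff[] /List.in_map_iff[y [<- ya]] /=.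
    - by rewrite subrr normr0; lra.
    - have := na x y xa ya; have := cf x y xa ya.
      have := dist_le1 x (n y); have := dist_le1 x (c y).
      by rewrite ler_norml; lra.
    - have := na y x ya xa; have := cf y x ya xa; rewrite (distC _ y) (distC (c x)).
      have := dist_le1 y (n x); have := dist_le1 y (c x).
      by rewrite ler_norml; lra.
    - by rewrite !imap_iso subrr normr0; lra.
  have ha x : List.In x a -> dist (h x) x <= 2 * r.
    move=> xa; have : List.In (x, x) l.
      by apply/List.in_app_iff; left; apply/List.in_map_iff; exists x.
    by move=> /hP /=; lra.
  exists (h * n * h^-1)%g.
    apply: WV => // x xs; apply: (le_trans (ha x _)); last by lra.
    by apply/List.in_app_iff; left.
  move=> x xa; have : List.In (n x, c x) l.
    by apply/List.in_app_iff; right; apply/List.in_map_iff; exists x.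
  move=> /hP /= hnc.
  change ((h * n * h^-1)%g x) with (h (n ((h^-1)%g x))).
  have := dist_triangle (h (n x)) (h (n ((h^-1)%g x))) (c x).
  by rewrite !imap_iso distV; have := ha x xa; rewrite (distC (h x)); lra.
have [v Vv vP] := conj k kf.
have [|w Vw wP] := conj (g^-1 * k)%g.
  move=> x y xa ya; change ((g^-1 * k)%g y) with ((g^-1)%g (k y)).
  by rewrite distC distV distC; exact: kg.
exists v, w, (v^-1 * g * w)%g; split=> //; last by rewrite !mulgA mulgK mulgV mul1g.
move=> x xA; have xa : List.In x a by apply/List.in_app_iff; right.
change ((v^-1 * g * w)%g x) with ((v^-1)%g (g (w x))); rewrite distV.
have := wP x xa; change ((g^-1 * k)%g x) with ((g^-1)%g (k x)).
rewrite distC distV distC; have := vP x xa.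
by have := dist_triangle (k x) (g (w x)) (v x); rewrite (distC (k x) (v x)); lra.
Qed.

End Spreading.
End FreeAmalgamation.

(** * Topological simplicity and minimality *)

Section IsometryGroupProperties.
Variables (R : realType) (G : topologicalGroupType) (M : gspace R G).
Local Notation H := (isometry M).
Hypotheses (sepM : separated M) (complM : complete_dist M) (realM : realizable M).

(** A nontrivial closed normal [N] is dense by [big_dense] for the family whose only member is
    [N]. *)
Lemma isometry_simple : topologically_simple H.
Proof.
move=> N clN [[N1 Ndiv] Nconj].
have {}N1 : N 1%g by exact: set_mem N1.
have {Ndiv}Ndiv f g : N f -> N g -> N (f * g^-1)%g.
  by move=> Nf Ng; apply: set_mem; apply: Ndiv; exact: mem_set.
have NV f : N f -> N (f^-1)%g by move=> Nf; rewrite -(mul1g f^-1%g); exact: Ndiv.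
have NM f g : N f -> N g -> N (f * g)%g.
  by move=> Nf Ng; rewrite -(invgK g); apply/Ndiv/NV.
have NJ h f : N f -> N (h * f * h^-1)%g.
  by move=> Nf; have := Nconj f (h^-1)%g Nf; rewrite conjgE invgK mulgA.
have [N0|nN0] := pselect (exists2 f : H, N f & f <> 1%g); last first.
  right; apply/seteqP; split=> f /=; last by move=> ->.
  by move=> Nf; apply: contrapT => f1; apply: nN0; exists f.
left; have [n Nn n1] := N0.
have [x nx] : exists x, n x <> x.
  apply: contrapT => nx; apply: n1; apply: isometry_ext => x /=.
  by apply: contrapT => nxx; apply: nx; exists x.
have r0 : 0 < dist (n x) x.
  by rewrite lt_def dist_ge0 andbT; apply/eqP => /sepM.
set r := dist (n x) x in r0.
apply/seteqP; split=> // g _; apply: clN => U [s [e [e0 sU]]].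
(* Conjugate [n] by an isometry that almost fixes [x] and moves [n x] away from [A]; the distance
   [r] survives up to two errors of [r / 4]. *)
have far V A : V = N -> exists2 f : H, V f & forall z, List.In z A -> r / 2 <= dist (f x) z.
  move=> ->; have r4 : 0 < r / 4 by lra.
  have [h [hx hP]] := free_amalgam realM [:: x] A [:: n x] r4.
  exists (h * n * h^-1)%g; first exact: NJ.
  move=> z zA; change ((h * n * h^-1)%g x) with (h (n ((h^-1)%g x))).
  have := hP z (n x) r zA (or_introl erefl) (dist_le1 _ _).
  have zr u : List.In u [:: x] -> r <= dist z u + dist u (n x).
    by move=> [<-|//]; rewrite (distC x (n x)) -/r; have := dist_ge0 z x; lra.
  move=> /(_ zr); have := hx x (or_introl erefl).
  have := dist_triangle (h (n ((h^-1)%g x))) z (h (n x)).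
  rewrite !imap_iso distV (distC z (h (n ((h^-1)%g x)))) (distC x (h x)).
  by lra.
have [||||||v [w [u [Nv Nw us gE]]]] := @big_dense _ _ M realM (fun V => V = N) _ _ _ _ _ x (r / 2) _ far N g s e erefl e0.
- by move=> V W -> ->; exists N.
- by move=> V ->; exists N.
- by move=> V ->; exists N.
- by move=> V h ->; exists N => // f; exact: NJ.
- by move=> V ->; exists N, [::], 1; split=> // f h Nf _; exact: NJ.
- by lra.
(* This element of [N] equals [g * u^-1], and [u] almost fixes [s]. *)
exists (v * (u * w^-1 * u^-1))%g; split; first by apply: NM => //; apply/NJ/NV.
apply: sU => y ys; rewrite gE !isometryME imap_iso.
change (dist (u ((w^-1)%g y)) (u ((w^-1)%g ((u^-1)%g y))) <= e).
by rewrite !imap_iso distC distV distC; exact: us.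
Qed.

Section Coarser.
Variable t : Topological H.
Let X : topologicalType := Topological.Pack t.
Hypotheses (tgrp : group_topology t) (thaus : hausdorff_space X).
Hypothesis tcoarse : @open X `<=` @open H.
Local Notation tnbhs := (@nbhs X X).

Let tcap (f : H) (U V : set H) : tnbhs f U -> tnbhs f V -> tnbhs f (U `&` V).
Proof. by move=> fU fV; apply: (@filterI _ _ (@nbhs_filter X f)). Qed.

Let tnbhs_coarse (f : H) U : tnbhs f U -> nbhs f U.
Proof.
rewrite (@nbhsE X) => -[V [oV Vf] VU]; rewrite nbhsE; exists V => //.
by split=> //; exact: (tcoarse oV).
Qed.

Let tmul (f g : H) U : tnbhs (f * g)%g U ->
  exists2 VW : set H * set H, tnbhs f VW.1 /\ tnbhs g VW.2 &
    forall f' g', VW.1 f' -> VW.2 g' -> U (f' * g')%g.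
Proof.
move=> /(tgrp.1 (f, g))[[V W] /= [fV gW] VW].
by exists (V, W) => // f' g' Vf' Wg'; exact: (VW (f', g')).
Qed.

Let tmul1 U : tnbhs 1%g U -> exists2 W, tnbhs 1%g W & forall f g, W f -> W g -> U (f * g)%g.
Proof.
rewrite -{1}(mulg1 1%g) => /tmul[[V W] /= [V1 W1] VW].
exists (V `&` W); first exact: tcap.
by move=> f g [Vf _] [_ Wg]; exact: VW.
Qed.

Let tinv1 U : tnbhs 1%g U -> exists2 W, tnbhs 1%g W & forall f, W f -> U (f^-1)%g.
Proof.
rewrite -{1}(invg1 H) => /(tgrp.2 1%g) U1.
by exists [set f : H | U (f^-1)%g].
Qed.

Let tmull (f g : H) U : tnbhs (f * g)%g U -> tnbhs g [set g' : H | U (f * g')%g].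
Proof.
move=> /tmul[[V W] /= [Vf Wg] VW]; apply: (@filterS _ _ (@nbhs_filter X g) W) => // g' Wg'.
by apply: VW => //; exact: (@nbhs_singleton X).
Qed.

Let tmulr (f g : H) U : tnbhs (f * g)%g U -> tnbhs f [set f' : H | U (f' * g)%g].
Proof.
move=> /tmul[[V W] /= [Vf Wg] VW]; apply: (@filterS _ _ (@nbhs_filter X f) V) => // f' Vf'.
by apply: VW => //; exact: (@nbhs_singleton X).
Qed.

Let tconj1 U (h : H) : tnbhs 1%g U -> exists2 W, tnbhs 1%g W & forall f, W f -> U (h * f * h^-1)%g.
Proof.
move=> U1; have : tnbhs (h * 1 * h^-1)%g U by rewrite mulg1 mulgV.
by move=> /tmulr/tmull U1'; exists [set f : H | U (h * f * h^-1)%g].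
Qed.

(** Coarseness enters here: a neighbourhood for [t] contains all isometries that almost fix some
    finite set. For such [h], both [h] and its inverse are small in [t]. *)
Let tlocal U : tnbhs 1%g U -> exists W (s : seq M) (e : R), [/\ tnbhs 1%g W, 0 < e &
  forall f h : H, W f -> (forall x, List.In x s -> dist (h x) x <= e) -> U (h * f * h^-1)%g].
Proof.
move=> /tmul1[V V1 VU]; have [W W1 WV] := tmul1 V1; have [W' W'1 W'V] := tinv1 V1.
have /tnbhs_coarse[s [e [e0 sW]]] : tnbhs 1%g (W `&` W') by exact: tcap.
exists W, s, e; split=> // f h Wf hs.
have [Wh W'h] : (W `&` W') h by apply: sW => x xs; rewrite isometry1E distC; exact: hs.
by apply: VU; [exact: WV|exact: W'V].
Qed.

Let tfar := exists (x : M) (e : R), 0 < e /\ forall V A, tnbhs 1%g V ->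
  exists2 g : H, V g & forall z, List.In z A -> e <= dist (g x) z.

(** Otherwise [big_dense] would make every neighbourhood of 1 for [t] the whole group. As [t] is
    Hausdorff the group would be trivial, and could not move [x] away from itself. *)
Let tfar_false : ~ tfar.
Proof.
move=> [x [e [e0 far]]].
have whole V (g : H) : tnbhs 1%g V -> V g.
  move=> /tmul1[V1 V11 V1V]; have [V2 V21 V2V1] := tmul1 V11.
  have [V3 V31 V3V1] := tinv1 V11.
  have V231 : tnbhs 1%g (V1 `&` (V2 `&` V3)) by do 2?apply: tcap.
  have /tnbhs_coarse[s [d [d0 sV]]] := V231.
  have [|||||v [w [u [Vv Vw us ->]]]] := @big_dense _ _ M realM (fun V => tnbhs 1%g V) _ _ _ _ _ x e e0 far _ g s d V231 d0.
  - by move=> U W U1 W1; exists (U `&` W) => //; exact: tcap.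
  - exact: tmul1.
  - exact: tinv1.
  - by move=> U h; exact: tconj1.
  - exact: tlocal.
  apply: V1V; last by apply: V3V1; exact: Vw.2.2.
  apply: V2V1; first exact: Vv.2.1.
  have : (V1 `&` (V2 `&` V3)) u by apply: sV => y ys; rewrite isometry1E distC; exact: us.
  by move=> [_ []].
have triv (g : H) : g = 1%g.
  apply/esym/thaus => A B A1 Bg; exists g; split; first exact: whole.
  exact: (@nbhs_singleton X).
have [g _ /(_ x (or_introl erefl))] := far setT [:: x] (@filterT _ _ (@nbhs_filter X 1%g)).
by rewrite (triv g) isometry1E distxx; lra.
Qed.

(** An ultrafilter containing a finite union contains one of its members. *)
Let ultra_list (F : set_system H) (FU : UltraFilter F) (A : seq M) (y : H -> M) e :
  F [set h | exists2 z, List.In z A & dist (y h) z <= e] ->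
  exists z, F [set h | dist z (y h) <= e].
Proof.
elim: A => [|z A IHA] FA.
  by have [h [z []]] := filter_ex FA.
have [Fz|Fz] := in_ultra_setVsetC [set h | dist z (y h) <= e] FU; first by exists z.
apply: IHA; apply: filterS2 FA Fz => h [u [<-|uA] hu] hz; last by exists u.
by exfalso; apply: hz; rewrite /= distC.
Qed.

(** Suppose [U] is not a neighbourhood for [t], and take an ultrafilter containing its complement
    and all neighbourhoods of 1 for [t]. Since [tfar] fails, small elements and their inverses move
    each point close to a finite set, so the ultrafilter converges pointwise to an isometry. It
    converges there for [t] too, so the limit is 1, and [U] belongs to the ultrafilter. *)
Let tnbhs1_fine U : nbhs (1%g : H) U -> tnbhs 1%g U.
Proof.
move=> U1; apply: contrapT => nU1; apply: tfar_false; apply: contrapT => nfar.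
have near x e : 0 < e -> exists V A, tnbhs 1%g V /\
    forall g : H, V g -> exists2 z, List.In z A & dist (g x) z <= e.
  move=> e0; apply: contrapT => nVA; apply: nfar; exists x, e; split=> // V A V1.
  apply: contrapT => nV; apply: nVA; exists V, A; split=> // g Vg.
  apply: contrapT => ngz; apply: nV; exists g => // z zA.
  by rewrite leNgt; apply/negP => /ltW gz; apply: ngz; exists z.
pose F0 : set_system H := within (~` U) (tnbhs 1%g).
have F0F : Filter F0 by apply: within_filter; exact: (@nbhs_filter X).
have F0P : ProperFilter F0.
  split=> // F0e; apply: nU1.
  by apply: (@filterS _ _ (@nbhs_filter X 1%g)) F0e => f fU; apply: contrapT => /fU.
have [F [FU F0F']] := ultraFilterLemma F0P.
have FP : ProperFilter F by exact: ultra_proper.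
have tF V : tnbhs 1%g V -> F V.
  by move=> V1; apply: F0F'; apply: (@filterS _ _ (@nbhs_filter X 1%g)) V1 => f Vf _.
have FnU : F (~` U).
  by apply: F0F'; apply: (@filterS _ _ (@nbhs_filter X 1%g) setT); [move=> f _ | exact: filterT].
have Fc x e : 0 < e -> exists y, F [set h : H | dist y (h x) <= e].
  move=> e0; have [V [A [V1 VA]]] := near x e e0.
  by apply: (@ultra_list F FU A (fun h : H => h x)); apply: filterS (tF _ V1) => h /VA.
have FVc x e : 0 < e -> exists y, F [set h : H | dist y ((h^-1)%g x) <= e].
  move=> e0; have [V [A [V1 VA]]] := near x e e0; have [W W1 WV] := tinv1 V1.
  by apply: (@ultra_list F FU A (fun h : H => (h^-1)%g x)); apply: filterS (tF _ W1) => h /WV/VA.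
have [l lP] := isometry_limit sepM complM FP Fc FVc.
have Fl V : nbhs l V -> F V.
  by move=> [s [e [e0 sV]]]; apply: filterS sV _; exact: near_on_filter.
have l1 : 1%g = l.
  apply: thaus => A B A1 Bl; apply: (@filter_ex _ F).
  by apply: filterI; [exact: tF|exact/Fl/tnbhs_coarse].
have FUU : F U by apply: Fl; rewrite -l1.
by have [f []] := filter_ex (filterI FUU FnU).
Qed.

Lemma coarser_open : @open X = @open H.
Proof.
apply/seteqP; split=> // A oA; rewrite (@openE X) => f Af.
have fA : @nbhs H H f A by apply: open_nbhs_nbhs; split.
have := tnbhs1_fine (nbhs1_mulgl fA); rewrite -{1}(mulgV f) => /tmulr.
by apply: (@filterS _ _ (@nbhs_filter X f)) => g /=; rewrite mulgVK.
Qed.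

End Coarser.

Lemma isometry_minimal : minimal_group H.
Proof. by move=> t tgrp thaus tcoarse; exact: coarser_open. Qed.

End IsometryGroupProperties.

(** * Roelcke precompactness *)

Section RoelckePrecompact.
Variables (R : realType) (G : topologicalGroupType) (M : gspace R G).
Local Notation H := (isometry M).
Hypothesis realM : realizable M.

(** The matrices of distances between [a] and its image lie in a finite-dimensional cube; round
    their entries to multiples of [N%:R^-1] and choose one isometry for each rounded matrix that
    occurs. *)
Lemma isometry_net (a : seq M) e : 0 < e -> exists2 F : set H, finite_set F &
  forall g : H, exists2 f, F f &
    forall x y, List.In x a -> List.In y a -> `|dist x (g y) - dist x (f y)| <= e.
Proof.
move=> e0; pose N := Num.bound e^-1.
have N0 : (0 : R) < N%:R.
  by apply: le_lt_trans (archi_boundP _); rewrite ?invr_ge0 ltW// invr_gt0.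
have Ne : N%:R^-1 <= e.
  by rewrite invf_ple ?posrE// ltW// archi_boundP// invr_ge0 ltW.
pose m := size a.
(* The distance 1 is rounded to [N] itself, hence [N.+1] possible values. *)
pose code (g : H) : {ffun 'I_m * 'I_m -> 'I_N.+1} :=
  [ffun p => inord (Num.truncn (N%:R * dist (tnth (in_tuple a) p.1) (g (tnth (in_tuple a) p.2))))].
have code_dist g f : code g = code f -> forall x y, List.In x a -> List.In y a ->
    `|dist x (g y) - dist x (f y)| <= e.
  move=> gf x y xa ya.
  have In_tnth z : List.In z a -> exists i : 'I_m, tnth (in_tuple a) i = z.
    rewrite /m; elim: a {m code gf xa ya} => [//|w s IHs] [<-|zs].
      by exists ord0.
    have [i <-] := IHs zs; exists (lift ord0 i).
    by rewrite !(tnth_nth w).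
  have [i <-] := In_tnth x xa; have [j <-] := In_tnth y ya.
  have /(congr1 val) := congr1 (fun c : {ffun _} => c (i, j)) gf.
  rewrite !ffunE /=; set d := dist _ _; set d' := dist _ _.
  have dN (b : R) : 0 <= b <= 1 -> (Num.truncn (N%:R * b) < N.+1)%N.
    move=> /andP[b0 b1]; rewrite ltnS -(@ler_nat R); apply: le_trans (_ : N%:R * b <= _).
      by have /andP[] := truncn_itv (mulr_ge0 (ltW N0) b0).
    by rewrite -[leRHS]mulr1 ler_pM2l.
  rewrite !inordK ?dN ?dist_ge0 ?dist_le1// => dd'.
  have := truncn_itv (mulr_ge0 (ltW N0) (dist_ge0 (tnth (in_tuple a) i) (g (tnth (in_tuple a) j)))).
  have := truncn_itv (mulr_ge0 (ltW N0) (dist_ge0 (tnth (in_tuple a) i) (f (tnth (in_tuple a) j)))).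
  rewrite -/d -/d' dd'; set k := Num.truncn _ => /andP[k1 k2] /andP[k3 k4].
  apply: le_trans Ne; rewrite -(ler_pM2l N0) mulfV ?gt_eqF//.
  rewrite -[X in X * _]gtr0_norm// -normrM mulrBr ler_norml.
  move: k2 k4; rewrite -natr1; lra.
(* Matrices that do not occur are represented by 1. *)
have /choice[rep repP] : forall c, exists f : H, (exists g, code g = c) -> code f = c.
  move=> c; have [[g gc]|nc] := pselect (exists g, code g = c); first by exists g.
  by exists 1%g.
exists (range rep); first exact: finite_image (finite_finset).
move=> g; exists (rep (code g)) => [|x y xa ya]; first by exists (code g).
by apply: code_dist => //; rewrite repP//; exists g.
Qed.

(** If [f] and [g] have almost the same matrix, some [h] almost fixes [a] and takes [f x] close to
    [g x]. Then [f^-1 * h^-1 * g] almost fixes [a] as well. *)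
Lemma isometry_roelcke_product (a : seq M) e : 0 < e -> exists2 F : set H, finite_set F &
  forall g : H, exists f h k : H, [/\ F f, g = (h * f * k)%g,
    near_on a e 1%g h & near_on a e 1%g k].
Proof.
move=> e0; have e2 : 0 < e / 2 by lra.
have [F finF FP] := isometry_net a e2; exists F => // g.
have [f Ff fg] := FP g; have e4 : 0 < e / 4 by lra.
pose l := List.map (fun x => (x, x)) a ++ List.map (fun x => (f x, g x)) a.
have [|h hP] := @almost_homogeneous _ _ _ realM l (e / 4) _ e4.
  split=> [|p q]; first by lra.
  move=> /List.in_app_iff[] /List.in_map_iff[x [<- xa]];
  move=> /List.in_app_iff[] /List.in_map_iff[y [<- ya]] /=.
  - by rewrite subrr normr0; lra.
  - by have := fg x y xa ya; rewrite distrC; lra.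
  - by have := fg y x ya xa; rewrite (distC y) (distC y) distrC; lra.
  - by rewrite !imap_iso subrr normr0; lra.
exists f, h, (f^-1 * h^-1 * g)%g; split=> //.
- by rewrite !mulgA mulgK mulgV mul1g.
- move=> x xa; have : List.In (x, x) l.
    by apply/List.in_app_iff; left; apply/List.in_map_iff; exists x.
  by move=> /hP /=; rewrite distC; lra.
- move=> x xa; have : List.In (f x, g x) l.
    by apply/List.in_app_iff; right; apply/List.in_map_iff; exists x.
  move=> /hP /= hfg; change (dist x ((f^-1)%g ((h^-1)%g (g x))) <= e).
  by rewrite distC !distV distC; lra.
Qed.

Lemma isometry_roelcke_precompact : roelcke_precompact H.
Proof.
move=> E entE.
(* A basic entourage of the supremum is a finite intersection of entourages of uniformities below
   both the left and the right one. *)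
have sub b A : @entourage (roelcke_uniform H) A ->
    @entourage (Uniform.Pack (if b then left_uniformity H else right_uniformity H)) A.
  move=> [B [D DE <-] BA]; set T := Uniform.Pack _.
  have FF : Filter (@entourage T) by exact: entourage_filter.
  apply: (@filterS _ _ FF _ _ BA); apply: filter_bigI => -[[/= u U] uU] _ /=; rewrite {FF}/T {T}.
  have {}uU := asboolP _ uU; case: u uU => [u [uL uR]] /= uU.
  by case: b; [exact: uL|exact: uR].
have [E' entE' E'E] := entourage_split_ex entE.
have [U U1 UE] := sub true _ entE'; have [W W1 WE] := sub false _ entE'.
have [s [e [e0 sUW]]] := filterI U1 W1.
have [F finF FP] := isometry_roelcke_product s e0; exists F => //.
apply/seteqP; split=> // g _; have [f [h [k [Ff -> hs ks]]]] := FP g.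
(* Pass from [f] to [h * f] in the right uniformity and on to [h * f * k] in the left one. *)
exists f => //; apply/xsectionP; apply: E'E; exists (h * f)%g.
  by apply: WE => /=; rewrite mulgK; exact: (sUW _ hs).2.
by apply: UE => /=; rewrite mulKg; exact: (sUW _ ks).1.
Qed.

End RoelckePrecompact.

(** * A small base of the isometry group *)

Section Weight.
Variables (R : realType) (G : topologicalGroupType) (M : gspace R G) (K : Type).
Local Notation H := (isometry M).
Hypotheses (smallKK : small K (K * K)) (small_nat : small K nat).
Variable D : K -> M.
Hypothesis D_dense : forall x e, 0 < e -> exists k, dist x (D k) <= e.

(** Finitely many conditions, each placing the image of one point of [D] in a ball of radius
    [n.+1%:R^-1] about another, define an open set; there are no more such systems than elements of
    [K]. *)
Lemma isometry_basis : exists B : K -> set H, basis (range B).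
Proof.
pose code := seq (K * K * nat)%type.
pose U (c : code) : set H := [set g : H | forall p, List.In p c ->
  dist (g (D p.1.1)) (D p.1.2) < p.2.+1%:R^-1].
have [s sP] : small K code.
  apply: small_seq => //; apply: small_prod => //.
have near_seq c g : U c g -> nbhs g (U c).
  elim: c => [|p c IHc] Ug; first by apply: filterS filterT => h _ p [].
  have pg := Ug p (or_introl erefl).
  have cg := IHc (fun q qc => Ug q (or_intror qc)).
  set r : R := p.2.+1%:R^-1 in pg.
  have r0 : 0 < (r - dist (g (D p.1.1)) (D p.1.2)) / 2 by lra.
  apply: filterS2 cg (near_on_nbhs [:: D p.1.1] g r0) => h hc hp q [<-|]; last exact: hc.
  have := hp _ (or_introl erefl); rewrite -/r.
  by have := dist_triangle (g (D p.1.1)) (h (D p.1.1)) (D p.1.2); rewrite (distC (h (D p.1.1)) (g (D p.1.1))); lra.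
exists (U \o s); split=> [_ [k _ <-]|g V [a [e [e0 aV]]]].
  by rewrite openE => g; exact: near_seq.
pose n := Num.bound (4 / e).
have n0 : (0 : R) < n.+1%:R by [].
have ne : n.+1%:R^-1 <= e / 4.
  rewrite invf_ple ?posrE//; last by lra.
  rewrite invf_div; have := archi_boundP (ltW (divr_gt0 (@ltr0n R 4) e0)).
  by rewrite -/n -natr1; lra.
(* With points of [D] this close to [x] and [g x], the isometry [g] satisfies the condition
   strictly, and any [h] that satisfies it has [h x] within [5 / 3] radii of [g x], hence within
   [e]. *)
have r0 : 0 < n.+1%:R^-1 / 3 :> R by rewrite divr_gt0// invr_gt0.
have [c cg cP] : exists2 c : code, U c g &
    forall h, U c h -> near_on a e g h.
  elim: a {aV} => [|x a [c cg cP]]; first by exists [::] => // h _ x [].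
  have [k kx] := D_dense x r0; have [k' k'x] := D_dense (g x) r0.
  exists ((k, k', n) :: c).
    move=> p [<-|] /=; last exact: cg.
    have := dist_triangle (g x) (g (D k)) (D k'); rewrite imap_iso (distC (D k)).
    by move: kx k'x; set r : R := n.+1%:R^-1; rewrite -/r in r0 *; lra.
  move=> h hc y [<-|ya]; last by apply: cP ya => p pc; apply: hc; right.
  have /= := hc _ (or_introl erefl).
  have := dist_triangle (D k') (g x) (h x).
  have := dist_triangle (h (D k)) (D k') (h x); rewrite imap_iso.
  rewrite (distC (D k') (h (D k))) (distC (D k) x).
  by move: kx k'x ne r0; set r : R := n.+1%:R^-1; lra.
exists (U c); last by move=> h /cP; exact: aV.
by split=> //; have [k <-] := sP c; exists k.
Qed.

End Weight.

(** * Cardinals *)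

Section Cardinals.

(* Zorn on the sets of simultaneous choices [phi i] in [C i] all of whose
   projections are injective: in a maximal one, some projection is onto. *)
Lemma least_card (I T : Type) (C : I -> set T) : inhabited I ->
  exists i0, forall i, exists2 f : T -> T, set_fun (C i0) (C i) f &
    {in C i0 &, injective f}.
Proof.
move=> [i1]; pose P (F : set (I -> T)) :=
  (forall phi, F phi -> forall i, C i (phi i)) /\
  (forall phi psi i, F phi -> F psi -> phi i = psi i -> phi = psi).
have [|F [[FC Finj] Fmax]] := @Zorn_bigcup _ P.
  move=> Fs FsP Ftot; split.
    by move=> phi [F /FsP[FC _] Fphi]; exact: FC.
  move=> phi psi i [F FsF Fphi] [F' FsF' Fpsi].
  have [FF'|F'F] := Ftot _ _ FsF FsF'.
    by apply: (FsP _ FsF').2 => //; exact: FF'.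
  by apply: (FsP _ FsF).2 => //; exact: F'F.
have [i0 i0P] : exists i0, forall x, C i0 x -> exists2 phi, F phi & phi i0 = x.
  apply: contrapT => nF.
  have /choice[psi psiP] : forall i, exists x, C i x /\ forall phi, F phi -> phi i <> x.
    move=> i; apply: contrapT => nx; apply: nF; exists i => x Cx.
    apply: contrapT => nphi; apply: nx; exists x; split=> // phi Fphi phix.
    by apply: nphi; exists phi.
  apply: (Fmax (F `|` [set psi])); first split.
  - by move=> phi Fphi; left.
  - move=> /(_ psi (or_intror erefl)) Fpsi.
    by have [_ /(_ psi Fpsi)] := psiP i1.
  - split=> [phi [Fphi|->] i|]; [exact: FC|exact: (psiP i).1|].
    move=> phi psi' i [Fphi|->] [Fpsi'|->] // e; first exact: Finj e.
      by have := (psiP i).2 _ Fphi e.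
    by have := (psiP i).2 _ Fpsi' (esym e).
exists i0 => i.
have /choice[phi phiP] : forall x, exists phi, C i0 x -> F phi /\ phi i0 = x.
  move=> x; have [Cx|nCx] := pselect (C i0 x); last by exists (fun _ => x).
  by have [phi Fphi phix] := i0P _ Cx; exists phi.
exists (fun x => phi x i); first by move=> x /phiP[Fphi _]; exact: FC.
move=> x y /set_mem/phiP[Fx xE] /set_mem/phiP[Fy yE] /(Finj _ _ _ Fx Fy) xy.
by rewrite -xE xy.
Qed.

(** * Pairs of elements of an infinite set *)

Section Square.
Variables (K : Type) (n : nat -> K).
Hypothesis n_inj : injective n.

Let dom (F : set (K * K * K)) x := exists z, F (x, x, z).

(** The set [F] is the graph of an injection of [A * A] into [A], where [A] is [dom F]. *)
Let square (F : set (K * K * K)) := [/\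
  forall p z z', F (p, z) -> F (p, z') -> z = z',
  forall p p' z, F (p, z) -> F (p', z) -> p = p',
  forall x y, (exists z, F (x, y, z)) <-> dom F x /\ dom F y &
  forall p z, F (p, z) -> dom F z].

Let F0 : set (K * K * K) :=
  [set t | exists i j, t = (n i, n j, n (choice.pickle (i, j)))].

Let square0 : square F0.
Proof.
have domE i : dom F0 (n i) by exists (n (choice.pickle (i, i))), i, i.
split.
- by move=> p z z' [i [j [-> ->]]] [i' [j' [/n_inj -> /n_inj -> ->]]].
- move=> p p' z [i [j [-> ->]]] [i' [j' [-> /n_inj]]].
  by move=> /(pcan_inj choice.pickleK)[-> ->].
- move=> x y; split=> [[z [i [j [-> -> _]]]]|[[z [i [j [-> _ _]]]] [z' [i' [j' [-> _ _]]]]]].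
    by split; exact: domE.
  by exists (n (choice.pickle (i, i'))), i, i'.
- by move=> p z [i [j [_ ->]]]; exact: domE.
Qed.

Let square_max : exists F, [/\ square F, F0 `<=` F &
  forall F', square F' -> F `<=` F' -> F' `<=` F].
Proof.
(* Joining [F0] inside the predicate takes care of the empty chain and keeps [F0] in the maximal
   graph. *)
have [|F [sF Fmax]] := @Zorn_bigcup _ (fun X => square (X `|` F0)).
  move=> Fs FsP Ftot; set U := \bigcup_(X in Fs) X `|` F0.
  have two t t' : U t -> U t' -> exists S, [/\ square S, S `<=` U, S t & S t'].
    have sub X : Fs X -> X `|` F0 `<=` U.
      by move=> FsX u [Xu|F0u]; [left; exists X|right].
    move=> [[X FsX Xt]|Ft] [[X' FsX' Xt']|Ft'].
    - have [XX'|X'X] := Ftot _ _ FsX FsX'.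
        exists (X' `|` F0); split; [exact: FsP|exact: sub|left; exact: XX'|by left].
      exists (X `|` F0); split; [exact: FsP|exact: sub|by left|left; exact: X'X].
    - by exists (X `|` F0); split; [exact: FsP|exact: sub|left|right].
    - by exists (X' `|` F0); split; [exact: FsP|exact: sub|right|left].
    - by exists F0; split=> // u Fu; right.
  have domS S x : S `<=` U -> dom S x -> dom U x by move=> SU [z /SU Uz]; exists z.
  split.
  - move=> p z z' Uz Uz'; have [S [[S1 _ _ _] _ Sz Sz']] := two _ _ Uz Uz'.
    exact: S1 Sz Sz'.
  - move=> p p' z Uz Uz'; have [S [[_ S2 _ _] _ Sz Sz']] := two _ _ Uz Uz'.
    exact: S2 Sz Sz'.
  - move=> x y; split=> [[z Uz]|[[z Uz] [z' Uz']]].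
      have [S [[_ _ S3 _] SU Sz _]] := two _ _ Uz Uz.
      have [] := (S3 x y).1 (ex_intro _ z Sz).
      by split; apply: domS SU _.
    have [S [[_ _ S3 _] SU Sz Sz']] := two _ _ Uz Uz'.
    have [|w Sw] := (S3 x y).2; first by split; [exists z|exists z'].
    by exists w; exact: SU.
  - move=> p z Uz; have [S [[_ _ _ S4] SU Sz _]] := two _ _ Uz Uz.
    by apply: domS SU _; exact: S4 Sz.
exists (F `|` F0); split=> //.
move=> F' sF' FF'; apply: contrapT => nF'F; apply: (Fmax F').
  split; first by move=> t Ft; apply: FF'; left.
  by move=> F'F; apply: nF'F => t /F'F; left.
suff -> : F' `|` F0 = F' by [].
by apply/seteqP; split=> t; [move=> [//|Ft]; apply: FF'; right|move=> Ft; left].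
Qed.

(** Let [A] be the domain of a maximal graph. If its complement embeds into [A], then so does [K],
    and pairs are coded inside [A]. Otherwise [A] embeds into its complement, which contradicts
    maximality. *)
Lemma infinite_square : exists f : K * K -> K, injective f.
Proof.
have [F [[F1 F2 F3 F4] F0F Fmax]] := square_max.
pose A := dom F.
have /choice[f fP] : forall p : K * K, exists z, A p.1 /\ A p.2 -> F (p, z).
  move=> [x y]; have [Axy|nA] := pselect (A x /\ A y); last by exists x.
  by have [z Fz] := (F3 x y).2 Axy; exists z.
have An i : A (n i).
  by exists (n (choice.pickle (i, i))); apply: F0F; exists i, i.
have Af x y : A x -> A y -> A (f (x, y)) by move=> Ax Ay; exact: (F4 _ _ (fP (x, y) (conj Ax Ay))).
have finj x y x' y' : A x -> A y -> A x' -> A y' -> f (x, y) = f (x', y') -> x = x' /\ y = y'.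
  move=> Ax Ay Ax' Ay' e; have := fP (x', y') (conj Ax' Ay'); rewrite -e.
  by move=> /(F2 _ _ _ (fP (x, y) (conj Ax Ay)))[-> ->].
have n01 i j : n i = n j -> i = j by exact: n_inj.
suff [g gA ginj] : exists2 g : K -> K, forall x, A (g x) & injective g.
  exists (fun p => f (g p.1, g p.2)) => -[x y] [x' y'] /= /finj.
  by move=> /(_ (gA _) (gA _) (gA _) (gA _))[/ginj -> /ginj ->].
have [b bP] := @least_card bool K (fun b => if b then A else ~` A) (inhabits true).
case: b bP => bP; last first.
  have [/= g gA ginj] := bP true.
  (* The first components [n 0] and [n 1] keep the images of [A] and of its complement apart. *)
  exists (fun x => if pselect (A x) then f (n 0%N, x) else f (n 1%N, g x)).
    by move=> x; case: pselect => Ax; apply: Af => //; exact: gA.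
  move=> x y; case: pselect => Ax; case: pselect => Ay.
  - by move=> /finj[].
  - by move=> /finj[] //; [exact: gA|move=> /n01].
  - by move=> /finj[] //; [exact: gA|move=> /n01].
  - move=> /finj[] //; [exact: gA|exact: gA|move=> _]; apply: ginj; exact: mem_set.
(* [g] embeds [A] into its complement, onto [A']: then [A] can be enlarged to
   the union of [A] and [A']. *)
have [/= g gA ginj] := bP false.
exfalso; pose A' := g @` A.
have AA' x : A x -> A' x -> False by move=> Ax [y Ay yx]; apply: (gA y Ay); rewrite yx.
have /choice[h hP] : forall x, exists y, (A x -> y = x) /\ (A' x -> A y /\ g y = x).
  move=> x; have [Ax|nAx] := pselect (A x).
    by exists x; split=> // A'x; have := AA' _ Ax A'x.
  have [[y Ay yx]|nA'x] := pselect (A' x); first by exists y.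
  by exists x.
(* Both coordinates are brought back to [A] by [h]; the tag tells the three kinds of new pairs
   apart, and the outer [g] puts the values into [A'], away from those of [F]. *)
pose tag x y := if pselect (A x) then 0%N else if pselect (A y) then 1%N else 2%N.
pose v x y := g (f (n (tag x y), f (h x, h y))).
pose F' : set (K * K * K) := F `|` [set t | exists x y,
  [/\ A x \/ A' x, A y \/ A' y, ~ (A x /\ A y) & t = (x, y, v x y)]].
have hA x : A x \/ A' x -> A (h x).
  by move=> [Ax|A'x]; [rewrite (hP x).1|exact: ((hP x).2 A'x).1].
have hinj x y : A x \/ A' x -> A y \/ A' y -> h x = h y -> (A x <-> A y) -> x = y.
  move=> [Ax|A'x] [Ay|A'y] hxy AxAy.
  - by rewrite -(hP x).1// hxy (hP y).1.
  - by have := AA' _ (AxAy.1 Ax) A'y.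
  - by have := AA' _ (AxAy.2 Ay) A'x.
  - by rewrite -((hP x).2 A'x).2 hxy ((hP y).2 A'y).2.
have vA' x y : A x \/ A' x -> A y \/ A' y -> A' (v x y).
  move=> /hA Ahx /hA Ahy; exists (f (n (tag x y), f (h x, h y))) => //.
  by apply: (Af _ _ (An _)); exact: Af.
have domF' x : A x \/ A' x -> dom F' x.
  move=> Ax; have [[z Fz]|nAx] := pselect (A x); first by exists z; left.
  by exists (v x x); right; exists x, x; split=> // -[].
have domF'V x : dom F' x -> A x \/ A' x.
  by move=> [z [Fz|[x' [y' [Ax' _ _ [-> _ _]]]]]]; [left; exists z|].
have FA x y z : F (x, y, z) -> A x /\ A y by move=> Fz; apply/F3; exists z.
have sF' : square F'; last first.
  have : F' `<=` F by apply: Fmax => // t Ft; left.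
  move=> F'F; have A'g : A' (g (n 0%N)) by exists (n 0%N).
  have [z /F'F Fz] := domF' _ (or_intror A'g).
  by apply: (AA' (g (n 0%N))) => //; exists z.
split.
- move=> p z z' [Fz|[x [y [Ax Ay nA [pE zE]]]]] [Fz'|[x' [y' [Ax' Ay' nA' [pE' zE']]]]].
  + exact: F1 Fz Fz'.
  + by move: Fz; rewrite pE' => /FA/nA'.
  + by move: Fz'; rewrite pE => /FA/nA.
  + by move: pE'; rewrite pE zE zE' => -[-> ->].
- move=> p p' z [Fz|[x [y [Ax Ay nA [-> ->]]]]] [Fz'|[x' [y' [Ax' Ay' nA' [-> zE']]]]].
  + exact: F2 Fz Fz'.
  + by exfalso; apply: (AA' z); [exact: F4 Fz|rewrite zE'; exact: vA'].
  + by exfalso; apply: (AA' (v x y)); [exact: F4 Fz'|exact: vA'].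
  + have Am a b c : A a \/ A' a -> A b \/ A' b -> A (f (n c, f (h a, h b))).
      by move=> /hA ? /hA ?; apply: (Af _ _ (An _)); exact: Af.
    move: zE' => /(ginj _ _ (mem_set (Am _ _ _ Ax Ay)) (mem_set (Am _ _ _ Ax' Ay'))).
    move=> /finj[]; rewrite ?An//; [by apply: Af; exact: hA|by apply: Af; exact: hA|].
    move=> /n01 tagE /finj[]; try exact: hA.
    move=> hx hy; have [Axx Ayy] : (A x <-> A x') /\ (A y <-> A y').
      move: tagE nA nA'; rewrite /tag.
      by case: (pselect (A x)) => ?; case: (pselect (A x')) => ?;
        case: (pselect (A y)) => ?; case: (pselect (A y')) => ? //; tauto.
    by rewrite (hinj x x')// (hinj y y').
- move=> x y; split=> [[z [Fz|[x' [y' [Ax Ay _ [-> -> _]]]]]]|[/domF'V Ax /domF'V Ay]].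
  + by have [Ax Ay] := FA _ _ _ Fz; split; apply: domF'; left.
  + by split; exact: domF'.
  + have [/F3[z Fz]|nA] := pselect (A x /\ A y); first by exists z; left.
    by exists (v x y); right; exists x, y.
- move=> p z [Fz|[x [y [Ax Ay _ [_ ->]]]]]; apply: domF'; first by left; exact: F4 Fz.
  by right; exact: vA'.
Qed.

End Square.
End Cardinals.

(** * The embedding *)

Section Embedding.
Variables (R : realType) (G : topologicalGroupType).
Hypothesis hG : hausdorff_space G.
Local Open Scope group_scope.

Lemma nbhs1_mulgr (g : G) (U : set G) : nbhs g U -> nbhs 1 [set u : G | U (g * u)].
Proof.
move=> gU; have /= := @mulg_continuous G (g, 1) U.
rewrite /= mulg1 => /(_ gU)[[A B] /= [A1 B1] AB].
apply: filterS B1 => x Bx; apply: (AB (g, x)); split=> //=.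
exact: nbhs_singleton.
Qed.

Variable M : gspace R G.
Hypothesis effective : forall U : set G, nbhs (1 : G) U ->
  exists (x : M) (e : R), (0 < e)%R /\ forall g, (dist (gact g x) x < e)%R -> U g.

Definition translation (g : G) : isometry M :=
  @Isometry _ _ M (gact g) (gact g^-1) (dist_gact g) (gactK g) (gactKV g).

Lemma translationM : {morph translation : g h / g * h}.
Proof. by move=> g h; apply: isometry_ext => x /=; rewrite gactM. Qed.

Lemma translation_inj : injective translation.
Proof.
move=> g h gh; suff : 1 = h^-1 * g by move/(canLR (mulVKg h)); rewrite mulg1.
apply: hG => A B A1 Bg; exists (h^-1 * g); split; last exact: nbhs_singleton.
have [x [e [e0 eA]]] := effective A1; apply: eA.
have -> : gact (h^-1 * g) x = x.
  by rewrite gactM -[gact g x]/(translation g x) gh /= gactK.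
by rewrite distxx.
Qed.

(** For each [g] in an open [A], effectiveness gives a point whose displacement detects membership
    in [A] near [g]; the union of the corresponding open sets of isometries has trace [A].
    Conversely, preimages of open sets are open because orbit maps are continuous. *)
Lemma translation_embedding : topological_group_embedding translation.
Proof.
split; [exact: translationM|exact: translation_inj|move=> A; split=> [oA|[B oB AB]]].
  have near g : exists p : M * R, A g -> (0 < p.2)%R /\
      forall h, (dist (gact h p.1) (gact g p.1) < p.2)%R -> A h.
    have [Ag|nAg] := pselect (A g); last first.
      (* A default value for [g] outside [A]; effectiveness for the whole group shows that [M] has a
         point. *)
      by have [x _] := effective (@filterT _ _ (nbhs_filter (1 : G))); exists (x, 1%R).
    have gA : nbhs g A by apply: open_nbhs_nbhs; split.
    have [x [e [e0 eA]]] := effective (nbhs1_mulgr gA).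
    exists (x, e) => _; split=> // h /= hx; rewrite -(mulVKg g h).
    by apply: eA; rewrite gactM -(dist_gact g) gactKV.
  have [p pP] := choice near.
  exists (\bigcup_(g in A) [set f : isometry M | (dist (f (p g).1) (gact g (p g).1) < (p g).2)%R]).
    apply: bigcup_open => g Ag; rewrite openE => f.
    set x := (p g).1; set e := (p g).2 => fg.
    have {}fg : (dist (f x) (gact g x) < e)%R := fg.
    have r0 : (0 < (e - dist (f x) (gact g x)) / 2)%R by lra.
    apply: filterS (near_on_nbhs [:: x] f r0) => h /(_ _ (or_introl erefl)) fh /=.
    rewrite -/x -/e; have := dist_triangle (f x) (h x) (gact g x).
    by rewrite (distC (h x) (f x)); lra.
  apply/seteqP; split=> [_ [g Ag <-]|f [[h _ <-] [g Ag hg]]].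
    by split; [exists g|exists g => //=; rewrite distxx; exact: (pP g Ag).1].
  by exists h => //; exact: ((pP g Ag).2 h hg).
have -> : A = translation @^-1` B.
  apply/seteqP; split=> [g Ag|g Bg].
    have [] : (range translation `&` B) (translation g) by rewrite -AB; exists g.
    by [].
  have : (translation @` A) (translation g) by rewrite AB; split=> //; exists g.
  by move=> [h Ah /translation_inj <-].
rewrite openE => g Bg.
have : nbhs (translation g) B by apply: open_nbhs_nbhs; split.
move=> [s [e [e0 sB]]].
apply: filterS (nbhs_mulgl g (near1_seq (List.map (gact g) s) e0)) => h hs.
apply: sB => x xs /=; rewrite distC.
have := hs _ (List.in_map _ _ _ xs).
by rewrite -gactM mulgVK.
Qed.

End Embedding.

(** * Construction of the overgroup *)

Section Construction.
Variables (R : realType) (G : topologicalGroupType) (K : Type).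
Hypotheses (smallKK : small K (K * K)) (small_nat : small K nat).
Variable b : K -> set G.
Hypothesis b_basis : basis (range b).

Let b_near (g : G) (U : set G) : nbhs g U -> exists2 k, b k g & b k `<=` U.
Proof. by move=> /b_basis.2[_ [[k _ <-] kg] kU]; exists k. Qed.

Lemma homogeneous_gspace : exists (M : gspace R G) (D : K -> M),
  [/\ separated M, complete_dist M, realizable M,
      forall (x : M) e, 0 < e -> exists k, dist x (D k) <= e &
      forall U : set G, nbhs (1%g : G) U ->
        exists (x : M) (e : R), (0 < e)%R /\ forall g, (dist (gact g x) x < e)%R -> U g].
Proof.
pose Y := limit (ruc_gspace R G).
(* For each basic neighbourhood of 1, a function whose displacement detects it; these points go into
   the small subset, so that the action stays effective. *)
have /choice[e0 e0P] : forall k, exists x : Y, nbhs (1%g : G) (b k) ->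
    forall g, dist (gact g x) x < 1 -> b k g.
  move=> k; have [bk|nbk] := pselect (nbhs (1%g : G) (b k)).
    have [f fP] := rucfun_separation R bk; exists (base_thread f) => _ g.
    exact: fP.
  by have [f _] := rucfun_separation R (@filterT _ _ (nbhs_filter (1%g : G))); exists (base_thread f).
(* One element of each nonempty basic open set: a dense family in [G]. *)
have /choice[g0 g0P] : forall k, exists g, b k !=set0 -> b k g.
  move=> k; have [[g bg]|nb] := pselect (b k !=set0); first by exists g.
  by exists 1%g.
have g0_dense (g : G) (U : set G) : nbhs (1%g : G) U -> exists k, U (g0 k * g^-1)%g.
  move=> /(nbhs_mulgl g)/b_near[k kg kU]; exists k.
  by apply/kU/g0P; exists g.
have [D [De0 Dact Dreal]] := lowenheim_skolem smallKK small_nat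
  (@limit_realization _ _ _) e0 g0.
pose M := completion g0_dense Dact.
have sepM : separated M by move=> x y; exact: completion_separated.
exists M, (hat D); split=> //.
- exact: completion_complete.
- move=> l e F r r0 le; have [f fP] := completion_realization Dreal F r0 le.
  exists (@Isometry _ _ M f (bwd f) (fwd_iso f)
    (fun x => sepM _ _ (fwdK f x)) (fun x => sepM _ _ (bwdK f x))) => x y.
  exact: fP.
- by move=> x e e_gt0; exact: hat_dense.
move=> U /b_near[k k1 kU].
have [k' k'E] := De0 k; exists (hat D k' : M), 1; split=> // g gk.
apply/kU/e0P => //; rewrite -?k'E.
  by apply: open_nbhs_nbhs; split=> //; apply: b_basis.1; exists k.
apply: le_lt_trans gk.
(* Evaluation at [gact g (D k')] bounds the displacement of [D k'] by that of its image in the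
   completion. *)
have := @le_supdist _ _ (fun y => dist (D k') (gact g^-1%g y)) (dist (D k')) (gact g (D k')).
rewrite gactK distxx sub0r normrN ger0_norm ?dist_ge0// distC.
by apply; exact: dist_le1.
Qed.

Lemma minimal_overgroup : hausdorff_space G ->
  exists (H : topologicalGroupType) (f : G -> H),
    [/\ hausdorff_space H, topological_group_embedding f,
        [/\ complete_group H, minimal_group H, roelcke_precompact H & topologically_simple H] &
        exists B : K -> set H, basis (range B)].
Proof.
move=> hG; have [M [D [sepM complM realM Ddense eff]]] := homogeneous_gspace.
exists (isometry M), (@translation _ _ M); split.
- exact: isometry_hausdorff.
- exact: translation_embedding.
- split.
  + exact: isometry_complete.
  + exact: isometry_minimal.
  + exact: isometry_roelcke_precompact.
  + exact: isometry_simple.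
- exact: isometry_basis Ddense.
Qed.

End Construction.

(** * Comparison of weights *)

Local Open Scope card_scope.

Lemma small_infinite (K : Type) : infinite_set [set: K] ->
  small K (K * K) /\ small K nat.
Proof.
move=> /infiniteP/card_leP/injfunPex[m _ m_inj].
pose n (i : nat) : K := set_val (m (to_setT i)).
have n_inj : injective n.
  by move=> i j /val_inj/m_inj ij; have /(congr1 set_val) := ij (in_setT _) (in_setT _).
have smallI (T : Type) (t0 : T) (f : T -> K) : injective f -> small K T.
  move=> f_inj; have /choice[s sP] : forall k, exists t, (exists t', f t' = k) -> f t = k.
    move=> k; have [[t tk]|nt] := pselect (exists t, f t = k); first by exists t.
    by exists t0.
  by exists s => t; exists (f t); apply: f_inj; apply: sP; exists t.
have [f f_inj] := infinite_square n_inj.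
by split; [apply: smallI f_inj; exact: (n 0%N, n 0%N)|exact: smallI 0%N _ n_inj].
Qed.

(** Apply [least_card] to the family of all bases. *)
Lemma minimum_basis_exists (T : topologicalType) : exists B : set_system T, minimum_basis B.
Proof.
pose I := {B : set_system T | basis B}.
have open_basis : basis (@open T).
  split=> // x A; rewrite nbhsE => -[B [oB Bx] BA].
  by exists B.
have [[B Bb] BP] := @least_card I (set T) sval (inhabits (exist _ _ open_basis)).
exists B; split=> // C Cb; have [f fC f_inj] := BP (exist _ C Cb).
have := inj_card_eq f_inj; rewrite card_eq_le => /andP[_ /card_le_trans]; apply.
by apply: subset_card_le => _ [U BU <-]; exact: fC.
Qed.

(** In a Hausdorff space a point is determined by the basic sets containing it, so a finite base
    allows only finitely many points. *)
Lemma basis_infinite (T : topologicalType) (B : set_system T) :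
  hausdorff_space T -> infinite_set [set: T] -> basis B -> infinite_set B.
Proof.
move=> hT infT [oB bB] /finite_seqP[s sE]; apply: infT.
pose phi (x : T) : {ffun 'I_(size s) -> bool} := [ffun i : 'I_(size s) => `[< nth set0 s i x >]].
have phi_inj : injective phi.
  move=> x y xy; apply: hT => A C xA yC.
  have [U [BU Ux] UA] := bB x A xA; exists y; split; last exact: nbhs_singleton.
  apply: UA; have Us : U \in s by rewrite sE in BU.
  have iU : (index U s < size s)%N by rewrite index_mem.
  have := congr1 (fun c : {ffun _} => c (Ordinal iU)) xy.
  by rewrite !ffunE /= !nth_index// => e; apply/asboolP; rewrite -e; apply/asboolP.
have phiT : {in [set: T] &, injective phi} by move=> x y _ _; exact: phi_inj.
by rewrite -(eq_finite_set (inj_card_eq phiT)); exact: finite_finset.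
Qed.

(** The preimages of the sets in [C] form a base of [G]. *)
Lemma embedding_weight (G H : topologicalGroupType) (f : G -> H)
    (B : set_system G) (C : set_system H) :
  topological_group_embedding f -> minimum_basis B -> basis C -> B #<= C.
Proof.
move=> [_ f_inj f_open] [_ Bmin] [oC bC].
apply: (@card_le_trans _ _ _ [set f @^-1` V | V in C]); last exact: card_image_le.
apply: Bmin; split=> [_ [V CV <-]|g A].
  apply/f_open; exists V; first exact: oC.
  apply/seteqP; split=> [_ [x Vx <-]|_ [[x _ <-] Vx]]; first by split=> //; exists x.
  by exists x.
rewrite nbhsE => -[U [/f_open[V oV UV] Ug] UA].
have Vg : V (f g) by have [] : (range f `&` V) (f g) by rewrite -UV; exists g.
have [W [CW Wg] WV] := bC (f g) V (open_nbhs_nbhs (conj oV Vg)).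
exists (f @^-1` W); first by split=> //; exists W.
move=> x Wx; apply: UA.
have : (f @` U) (f x) by rewrite UV; split; [exists x|exact: WV].
by move=> [y Uy /f_inj <-].
Qed.

(** The construction needs an infinite index type, hence an enumeration by [nat]: lists of booleans
    code subsets along [s], and codes of sets that are not open give the empty set. *)
Lemma finite_basis (T : topologicalType) : finite_set [set: T] ->
  exists b : nat -> set T, basis (range b).
Proof.
move=> /finite_seqP[s sT].
have [d dP] : small nat (seq bool) := small_count (small_id nat) [::].
pose U (l : seq bool) : set T := [set x | nth false l (index x s)].
pose b n := if pselect (open (U (d n))) then U (d n) else set0.
exists b; split=> [_ [n _ <-]|x A].
  by rewrite /b; case: pselect => [//|nU]; exact: open0.
rewrite nbhsE => -[V [oV Vx] VA]; have [n dn] := dP [seq `[< V y >] | y <- s].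
have UV : U (d n) = V.
  apply/seteqP; split=> y; have ys : y \in s by have : [set: T] y by []; rewrite sT.
    by rewrite /U dn /= (nth_map y) ?index_mem// nth_index// => /asboolP.
  by move=> Vy; rewrite /U dn /= (nth_map y) ?index_mem// nth_index//; apply/asboolP.
exists V => //; split=> //; exists n => //.
by rewrite /b; case: pselect => //; rewrite UV.
Qed.

Theorem theorem1p3 (G : topologicalGroupType) (hG : hausdorff_space G) :
  exists (H : topologicalGroupType) (f : G -> H),
    hausdorff_space H /\
    topological_group_embedding f /\
    complete_group H /\
    minimal_group H /\
    roelcke_precompact H /\
    topologically_simple H /\
    (infinite_set [set: G] -> same_weight G H) /\
    (finite_set [set: G] -> @second_countable H).
Proof.
have [finG|infG] := pselect (finite_set [set: G]).
  (* For finite [G] the index type is [nat], which makes the overgroup second countable. *)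
  have [b bP] := finite_basis finG.
  have smallNN : small nat (nat * nat) := small_count (small_id nat) (0%N, 0%N).
  have [H [f [hH fe [cH mH rH sH] [C bC]]]] :=
    minimal_overgroup Rdefinitions.R smallNN (small_id nat) bP hG.
  exists H, f; do 6 (split; first by []); split=> [/(_ finG)//|_].
  by exists (range C) => //; exact: card_image_le.
have [B Bmin] := minimum_basis_exists G.
(* For infinite [G] the minimum base itself, made into a type, is the index type. *)
have infB : infinite_set [set: B].
  have infB0 := basis_infinite hG infG Bmin.1.
  by move=> finB; apply: infB0; rewrite -(eq_finite_set (card_setT B)).
have [smallBB smallN] := small_infinite infB.
have bB : basis (range (set_val : B -> set G)).
  rewrite (_ : range _ = B); first exact: Bmin.1.
  apply/seteqP; split=> [_ [U _ <-]|U BU]; first exact: set_mem (valP U).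
  by exists (exist _ U (mem_set BU)).
have [H [f [hH fe [cH mH rH sH] [C bC]]]] := minimal_overgroup Rdefinitions.R smallBB smallN bB hG.
exists H, f; do 6 (split; first by []); split=> [_|/infG//].
have [D Dmin] := minimum_basis_exists H.
(* The weight of [G] is at most that of [H] by embedding; conversely [H] has a base indexed by
   [B]. *)
exists B, D; split=> //; rewrite card_eq_le (embedding_weight fe Bmin Dmin.1)/=.
apply: card_le_trans (Dmin.2 _ bC) _.
apply: card_le_trans (card_image_le _ _) _.
by have := card_setT B; rewrite card_eq_le => /andP[].
Qed.
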